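(* Let $X$ be a metric space with bounded geometry, and $p \in \{0\}\cup[1,\infty]$. If $p\in (1,\infty)$, assume in addition that $X$ has Property A. Then the $\ell^p$-uniform Roe algebra $B^p_u(X)$ is closed under taking inverses (in $\mathfrak{B}(\ell^p(X))$), and, for any Banach space $E$ (with $X$ strongly discrete), the band-dominated operator algebra $\mathcal{A}^p_E(X)$ is closed under taking inverses (in $\mathfrak{B}(\ell^p_E(X))$).
   Context: Bounded geometry: for every $R\ge 0$, $\sup_{x\in X}\sharp B(x,R)<\infty$, where $B(x,R)$ is the closed ball and $\sharp$ denotes cardinality. $X$ is strongly discrete if $\{d(x,y):x,y\in X\}$ is discrete. Spaces: for $p\in[1,\infty)$, $\ell^p_E(X)=\ell^p(X;E)$ is the Banach space of $p$-summable functions $X\to E$ (counting measure); $\ell^\infty_E(X)$ is the Banach space of bounded functions $X\to E$; $\ell^0_E(X)=c_0(X;E)$ is the Banach space of (continuous) functions $X\to E$ vanishing at infinity, with sup-norm. $\ell^p(X)=\ell^p_{\mathbb C}(X)$. $\mathfrak{B}(\cdot)$ denotes bounded linear operators. $C_b(X)$ is the algebra of bounded continuous complex-valued functions on $X$, acting on $\ell^p_E(X)$ by point-wise multiplication. An operator $a\in\mathfrak{B}(\ell^p_E(X))$ has finite propagation if there is $R\ge0$ with $faf'=0$ whenever $f,f'\in C_b(X)$ with $d(\mathrm{supp}(f),\mathrm{supp}(f'))>R$. $B^p_u(X)$ is the norm-closure in $\mathfrak{B}(\ell^p(X))$ of the set of all finite propagation operators in $\mathfrak{B}(\ell^p(X))$.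 For $X$ strongly discrete, $\mathcal{A}^p_E(X)$ is the norm-closure in $\mathfrak{B}(\ell^p_E(X))$ of the set of all finite propagation operators in $\mathfrak{B}(\ell^p_E(X))$. A subalgebra $A\subseteq\mathfrak{B}(\ell^p_E(X))$ is closed under taking inverses if whenever $a\in A$ is invertible in $\mathfrak{B}(\ell^p_E(X))$, then $a^{-1}\in A$. Property A: for $p\in[1,\infty)$, a metric $p$-partition of unity on $X$ is a collection $\{\phi_i:X\to[0,1]\}_{i\in I}$ such that $\{\mathrm{supp}(\phi_i)\}_{i\in I}$ is uniformly bounded ($\sup_i\mathrm{diam}(\mathrm{supp}(\phi_i))<\infty$) and of finite multiplicity (some $M$ such that each $x\in X$ lies in at most $M$ of the supports), and $\sum_{i}\phi_i(x)^p=1$ for every $x$. It has $(r,\varepsilon)$-variation if $\sum_{i}|\phi_i(x)-\phi_i(y)|^p<\varepsilon^p$ whenever $d(x,y)\le r$. $X$ has Property A if for any $r,\varepsilon>0$ there exists a metric $p$-partition of unity with $(r,\varepsilon)$-variation (this is independent of $p\in[1,\infty)$). *)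

(* Defs.v *)
From HB Require Import structures.
From mathcomp Require Import all_boot all_order all_algebra.
From mathcomp.real_closed Require Import complex.
From mathcomp Require Import all_classical all_reals all_analysis.
From mathcomp Require Import ring.

Set Implicit Arguments.
Unset Strict Implicit.
Unset Printing Implicit Defensive.

Import Order.TTheory GRing.Theory Num.Theory.
Import numFieldNormedType.Exports.

Local Open Scope classical_set_scope.
Local Open Scope ring_scope.
Local Open Scope complex_scope.

(* The norm of a normed module over [R[i]] takes its values in [R[i]];
   [rnorm] is the same norm with values in [R]. *)
Definition rnorm (R : realType) (V : normedModType R[i]) (v : V) : R :=
  complex.Re `|v|.

Section rnorm_theory.
Context {R : realType} {V : normedModType R[i]}.
Implicit Types v w : V.

Lemma rnormE v : `|v| = (rnorm v)%:C.
Proof. by rewrite RRe_real// ger0_real. Qed.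

Lemma rnorm_ge0 v : 0 <= rnorm v.
Proof. by rewrite -ler0c -rnormE. Qed.

Lemma ler_rnormD v w : rnorm (v + w) <= rnorm v + rnorm w.
Proof. by rewrite -lecR rmorphD/= -!rnormE ler_normD. Qed.

Lemma rnormZ (l : R[i]) v : rnorm (l *: v) = complex.Re `|l| * rnorm v.
Proof.
by apply: complexI; rewrite rmorphM/= -!rnormE normrZ.
Qed.

Lemma rnorm0 : rnorm (0 : V) = 0.
Proof. by rewrite /rnorm normr0. Qed.

Lemma rnorm0_eq0 v : rnorm v = 0 -> v = 0.
Proof. by move=> v0; apply/normr0_eq0; rewrite rnormE v0. Qed.

End rnorm_theory.

Lemma Re_norm_gt0 (R : realType) (l : R[i]) : l != 0 -> 0 < complex.Re `|l|.
Proof. by move=> l0; rewrite -ltcR RRe_real ?ger0_real// normr_gt0. Qed.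

Lemma Re_normV (R : realType) (l : R[i]) : complex.Re `|l^-1| = (complex.Re `|l|)^-1.
Proof.
have e (z : R[i]) : real_complex R (complex.Re `|z|) = `|z|.
  by rewrite RRe_real ?ger0_real.
by apply: (@complexI R); rewrite e normfV -e fmorphV.
Qed.

Lemma bounded_fun_rnorm (R : realType) (T : Type) (V : normedModType R[i])
    (f : T -> V) :
  bounded_fun f <-> exists M : R, forall x, rnorm (f x) <= M.
Proof.
split=> [/ex_strict_bound_gt0[M M0 fM]|[M fM]].
  exists (complex.Re M) => x; have /ltW := fM x I.
  by rewrite rnormE lecE => /andP[_].
exists M%:C; split; first by apply/complex_realP; exists M.
by move=> r /ltW Mr x _; apply: le_trans Mr; rewrite rnormE lecR.
Qed.

Lemma esumZ_le (R : realType) (T : choiceType) (k : R) (a : T -> R) :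
  0 <= k -> (forall x, 0 <= a x) ->
  (\esum_(x in [set: T]) (k * a x)%:E <= k%:E * \esum_(x in [set: T]) (a x)%:E)%E.
Proof.
move=> k0 a0; apply: ge_ereal_sup => _ [F [finF _] <-].
under eq_fsbigr do rewrite EFinM.
rewrite -ge0_mule_fsumr; last by move=> x; rewrite lee_fin.
by rewrite lee_wpmul2l ?lee_fin//; apply: ereal_sup_ubound; exists F.
Qed.

Lemma powRD_convex (R : realType) (r s t a b : R) :
  1 <= r -> 0 < s -> 0 < t -> 0 <= a -> 0 <= b ->
  (a + b) `^ r <= (s + t) `^ r * (s / (s + t)) * (a / s) `^ r
                + (s + t) `^ r * (t / (s + t)) * (b / t) `^ r.
Proof.
move=> r1 s0 t0 a0 b0; have st0 : 0 < s + t by rewrite addr_gt0.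
have u0 : 0 <= s / (s + t) by rewrite divr_ge0 ?(ltW s0) ?(ltW st0).
have u1 : s / (s + t) <= 1 by rewrite ler_pdivrMr// mul1r lerDl ltW.
have := @convex_powR R r r1 (Itv01 u0 u1) (a / s) (b / t).
rewrite !inE/= !in_itv/= !andbT !divr_ge0//; try exact: ltW.
move=> /(_ isT isT).
have t1 : 1 - s / (s + t) = t / (s + t) by field; rewrite gt_eqF.
have ab : s / (s + t) * (a / s) + (1 - s / (s + t)) * (b / t) = (a + b) / (s + t).
  by field; rewrite !gt_eqF.
move=> h0.
have h : (s / (s + t) * (a / s) + (1 - s / (s + t)) * (b / t)) `^ r <=
  s / (s + t) * (a / s) `^ r + (1 - s / (s + t)) * (b / t) `^ r by exact: h0.
rewrite {h0}ab t1 in h.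
have -> : (a + b) `^ r = (s + t) `^ r * ((a + b) / (s + t)) `^ r.
  by rewrite -powRM ?divr_ge0 ?addr_ge0 ?(ltW s0) ?(ltW t0)//
    mulrCA divff ?gt_eqF// mulr1//.
rewrite -(mulrA _ (s / _)) -(mulrA _ (t / _)) -mulrDr.
by rewrite ler_wpM2l ?powR_ge0.
Qed.

Section lp_finite.
Context {R : realType} {X : choiceType} {E : normedModType R[i]} (r : R).
Hypothesis r1 : 1 <= r.
Implicit Types f g : X -> E.

Definition psum f : \bar R := (\esum_(x in [set: X]) (rnorm (f x) `^ r)%:E)%E.

Let r0 : 0 < r. Proof. exact: lt_le_trans r1. Qed.

Lemma psum_ge0 f : (0 <= psum f)%E.
Proof. by apply: esum_ge0 => x _; rewrite lee_fin powR_ge0. Qed.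

Lemma psum_dom f g (M : R) : 0 <= M ->
  (forall x, rnorm (g x) <= M * rnorm (f x)) ->
  (psum g <= (M `^ r)%:E * psum f)%E.
Proof.
move=> M0 gf; apply: le_trans (esumZ_le _ _); rewrite ?powR_ge0//; last first.
  by move=> x; rewrite powR_ge0.
apply: le_esum => x _; rewrite lee_fin -powRM ?rnorm_ge0//.
by rewrite ge0_ler_powR ?(ltW r0) ?nnegrE ?mulr_ge0 ?rnorm_ge0.
Qed.

Lemma psumD f g (s t : R) : 0 < s -> 0 < t ->
  (psum f <= (s `^ r)%:E)%E -> (psum g <= (t `^ r)%:E)%E ->
  (psum (fun x => (f x + g x)%R) <= ((s + t) `^ r)%:E)%E.
Proof.
move=> s0 t0 fs gt; have st0 : 0 < s + t by rewrite addr_gt0.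
pose c (u : R) := (s + t) `^ r * (u / (s + t)) * (u `^ r)^-1.
have c0 u : 0 < u -> 0 <= c u.
  move=> u0; rewrite /c !mulr_ge0 ?powR_ge0 ?invr_ge0 ?powR_ge0 ?(ltW u0)//.
  exact: ltW.
have cE u : 0 < u -> c u * u `^ r = (s + t) `^ r * (u / (s + t)).
  by move=> u0; rewrite /c divfK// gt_eqF// powR_gt0.
apply: (@le_trans _ _ ((c s)%:E * psum f + (c t)%:E * psum g)%E); last first.
  apply: (@le_trans _ _ ((c s * s `^ r)%:E + (c t * t `^ r)%:E)%E).
    by rewrite (EFinM (c s)) (EFinM (c t)) leeD// lee_wpmul2l// lee_fin c0.
  rewrite -EFinD lee_fin !cE// -mulrDr -mulrDl divff ?gt_eqF// mulr1//.
apply: (le_trans _ (leeD (esumZ_le _ _) (esumZ_le _ _))); rewrite ?c0//;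
  try by move=> x; rewrite powR_ge0.
rewrite -esumD; first last.
- by move=> x _; rewrite lee_fin mulr_ge0 ?powR_ge0// c0.
- by move=> x _; rewrite lee_fin mulr_ge0 ?powR_ge0// c0.
apply: le_esum => x _; rewrite -EFinD lee_fin.
apply: (@le_trans _ _ ((rnorm (f x) + rnorm (g x)) `^ r)).
  by rewrite ge0_ler_powR ?(ltW r0) ?nnegrE ?addr_ge0 ?rnorm_ge0//= ler_rnormD.
apply: le_trans (powRD_convex r1 s0 t0 _ _) _; rewrite ?rnorm_ge0//.
have pV u : 0 < u -> u^-1 `^ r = (u `^ r)^-1.
  by move=> u0; rewrite -(powR_inv1 (ltW u0)) -powRrM mulN1r powRN.
rewrite !powRM ?invr_ge0 ?rnorm_ge0 ?(ltW s0) ?(ltW t0)// !pV// /c.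
by rewrite !mulrA !(mulrAC _ (_ `^ r) (_ `^ r)^-1).
Qed.

Lemma psum_fine_le f (s : R) : (psum f < +oo)%E -> 0 <= s ->
  (fine (psum f) `^ r^-1 <= s) = (psum f <= (s `^ r)%:E)%E.
Proof.
move=> foo s0.
have ff : psum f \is a fin_num by rewrite ge0_fin_numE// psum_ge0.
rewrite -[in RHS](fineK ff) lee_fin.
have p0 : 0 <= fine (psum f) by rewrite fine_ge0// psum_ge0.
apply/idP/idP => h.
  have : (fine (psum f) `^ r^-1) `^ r <= s `^ r.
    by rewrite ge0_ler_powR ?nnegrE ?powR_ge0// ltW.
  by rewrite -powRrM mulVf ?gt_eqF// powRr1.
have : (fine (psum f)) `^ r^-1 <= (s `^ r) `^ r^-1.
  by rewrite ge0_ler_powR ?nnegrE ?powR_ge0// invr_ge0 ltW.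
by rewrite -powRrM divff ?gt_eqF// powRr1.
Qed.

End lp_finite.

Section lp_predicate.
Context {R : realType} {X : metricType R} {E : normedModType R[i]}.
Implicit Types (f g : X -> E) (p : \bar R).

Definition vanishes_at_infinity f : Prop :=
  forall e : R, 0 < e ->
    exists2 K : set X, compact K & forall x, ~ K x -> rnorm (f x) < e.

Definition sup_norm f : R := sup (range (fun x => rnorm (f x))).

(* The exponent [0] stands for c_0, as in the notation l^0_E(X) = c_0(X; E). *)
Definition lp_exponent p : Prop := p = 0%E \/ (1 <= p)%E.

Definition lp_mem p f : Prop :=
  match p with
  | r%:E => if r == 0 then continuous f /\ vanishes_at_infinity f
            else (psum r f < +oo)%E
  | +oo%E => bounded_fun f
  | -oo%E => False
  end.

Definition lp_norm p f : R :=
  match p with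
  | r%:E => if r == 0 then sup_norm f else fine (psum r f) `^ r^-1
  | _ => sup_norm f
  end.

Lemma lp_exponent_ind (P : \bar R -> Prop) :
  P 0%E -> (forall r, 1 <= r -> r != 0 -> P r%:E) -> P +oo%E ->
  forall p, lp_exponent p -> P p.
Proof.
move=> P0 Pr Poo p [->//|]; case: p => [r|//|//].
by rewrite lee_fin => r1; apply: Pr => //; rewrite gt_eqF// (lt_le_trans ltr01).
Qed.

Lemma rnorm_continuous : continuous (@rnorm R E).
Proof.
move=> v; apply/cvgrPdist_lt => e e0.
have e0' : 0 < e%:C by rewrite ltcR.
near=> w; apply: (@le_lt_trans _ _ (rnorm (v - w))); last first.
  by rewrite -ltcR -rnormE; near: w; exact: cvgr_dist_lt.
have h (a b : E) : rnorm a - rnorm b <= rnorm (a - b).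
  by rewrite lerBlDr; apply: le_trans (ler_rnormD _ _); rewrite subrK.
rewrite ler_norml h andbT lerNl opprB (le_trans (h _ _))//.
by rewrite -lecR -!rnormE distrC.
Unshelve. all: by end_near. Qed.

Lemma sup_norm_le f (c : R) : 0 <= c -> (forall x, rnorm (f x) <= c) ->
  sup_norm f <= c.
Proof.
move=> c0 fc; rewrite /sup_norm.
have [->|/set0P S0] := eqVneq (range (fun x => rnorm (f x))) set0.
  by rewrite sup0.
by apply: ge_sup => // _ [x _ <-].
Qed.

Lemma sup_norm_ub f x : bounded_fun f -> rnorm (f x) <= sup_norm f.
Proof.
move=> /bounded_fun_rnorm[M fM]; apply: ub_le_sup; last by exists x.
by exists M => _ [y _ <-].
Qed.

Lemma sup_norm_ge0 f : bounded_fun f -> 0 <= sup_norm f.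
Proof.
move=> bf; rewrite /sup_norm.
have [->|/set0P[_ [x _ _]]] := eqVneq (range (fun x => rnorm (f x))) set0.
  by rewrite sup0.
exact: le_trans (rnorm_ge0 _) (sup_norm_ub x bf).
Qed.

Lemma c0_bounded f : lp_mem 0%E f -> bounded_fun f.
Proof.
rewrite /lp_mem/= eqxx => -[cf vf]; apply/bounded_fun_rnorm.
have [K cK Kf] := vf _ ltr01.
have /compact_bounded[M [_ MK]] :
    compact ((fun x => rnorm (f x) : R^o) @` K).
  apply: continuous_compact => //; apply: continuous_subspaceT => x.
  by apply: continuous_comp; [exact: cf|exact: rnorm_continuous].
exists (Num.max 1 (M + 1)) => x; have [Kx|/Kf/ltW] := pselect (K x).
  rewrite le_max; apply/orP; right.
  have := MK (M + 1); rewrite ltrDl ltr01 => /(_ isT (rnorm (f x))).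
  by rewrite /= ger0_norm ?rnorm_ge0//; apply; exists x.
by move=> f1; rewrite le_max f1.
Qed.

Lemma lp_norm_ge0 p f : lp_exponent p -> lp_mem p f -> 0 <= lp_norm p f.
Proof.
elim/lp_exponent_ind => [/c0_bounded|r r1 r0|]; rewrite /lp_mem /lp_norm/= ?eqxx.
- exact: sup_norm_ge0.
- by rewrite (negbTE r0) => _; exact: powR_ge0.
- exact: sup_norm_ge0.
Qed.

Lemma lp_dom p f g (M : R) : lp_exponent p -> lp_mem p f -> 0 <= M ->
  (continuous f -> continuous g) ->
  (forall x, rnorm (g x) <= M * rnorm (f x)) ->
  lp_mem p g /\ lp_norm p g <= M * lp_norm p f.
Proof.
elim/lp_exponent_ind => [f0|r r1 r0 fr|fb] M0 cg gf.
- have bf := c0_bounded f0; move: f0; rewrite /lp_mem /lp_norm/= eqxx.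
  move=> [cf vf]; split; [split; [exact: cg|]|]; last first.
    apply: sup_norm_le => [|x]; first by rewrite mulr_ge0 ?sup_norm_ge0.
    by rewrite (le_trans (gf x))// ler_wpM2l// sup_norm_ub.
  move=> e e0; have [K cK Kf] := vf (e / (M + 1)) ltac:(by
    rewrite divr_gt0// ltr_wpDl).
  exists K => // x /Kf fx; rewrite (le_lt_trans (gf x))//.
  rewrite ltr_pdivlMr ?ltr_wpDl// in fx.
  by apply: le_lt_trans fx; rewrite mulrC ler_wpM2l ?rnorm_ge0// lerDl.
- move: fr; rewrite /lp_mem /lp_norm (negbTE r0) => fr.
  have le1 : (psum r g <= (M `^ r)%:E * psum r f)%E by exact: psum_dom.
  have gr : (psum r g < +oo)%E.
    apply: le_lt_trans le1 _.
    by rewrite lte_mul_pinfty ?lee_fin ?powR_ge0.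
  split => //; rewrite psum_fine_le// ?mulr_ge0 ?powR_ge0//.
  apply: le_trans le1 _; rewrite powRM ?powR_ge0// EFinM.
  rewrite lee_wpmul2l ?lee_fin ?powR_ge0//.
  by rewrite -psum_fine_le// powR_ge0.
- rewrite /lp_mem /lp_norm in fb *.
  have gb : forall x, rnorm (g x) <= M * sup_norm f.
    by move=> x; rewrite (le_trans (gf x))// ler_wpM2l// sup_norm_ub.
  split; first by apply/bounded_fun_rnorm; exists (M * sup_norm f).
  by apply: sup_norm_le => //; rewrite mulr_ge0 ?sup_norm_ge0.
Qed.

Lemma lpD p f g : lp_exponent p -> lp_mem p f -> lp_mem p g ->
  lp_mem p (fun x => f x + g x) /\
  lp_norm p (fun x => f x + g x) <= lp_norm p f + lp_norm p g.
Proof.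
have supD f' g' : bounded_fun f' -> bounded_fun g' ->
    bounded_fun (fun x => f' x + g' x) /\
    sup_norm (fun x => f' x + g' x) <= sup_norm f' + sup_norm g'.
  move=> bf bg; have le1 x : rnorm (f' x + g' x) <= sup_norm f' + sup_norm g'.
    by rewrite (le_trans (ler_rnormD _ _))// lerD ?sup_norm_ub.
  split; first by apply/bounded_fun_rnorm; exists (sup_norm f' + sup_norm g').
  by apply: sup_norm_le => //; rewrite addr_ge0 ?sup_norm_ge0.
elim/lp_exponent_ind => [f0 g0|r r1 r0 fr gr|]; last exact: supD.
- have bf := c0_bounded f0; have bg := c0_bounded g0.
  move: f0 g0; rewrite /lp_mem /lp_norm/= eqxx => -[cf vf] [cg vg].
  split; last exact: (supD _ _ bf bg).2.
  split=> [x|e e0]; first by apply: continuousD; [exact: cf|exact: cg].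
  have e20 : 0 < e / 2 by rewrite divr_gt0.
  have [K cK Kf] := vf _ e20; have [L cL Lg] := vg _ e20.
  exists (K `|` L); first exact: compactU.
  move=> x /not_orP[/Kf fx /Lg gx].
  by rewrite (le_lt_trans (ler_rnormD _ _))// (splitr e) ltrD.
- move: fr gr; rewrite /lp_mem /lp_norm (negbTE r0) => fr gr.
  have s0 : 0 <= fine (psum r f) `^ r^-1 by exact: powR_ge0.
  have t0 : 0 <= fine (psum r g) `^ r^-1 by exact: powR_ge0.
  have sE c : 0 <= c -> fine (psum r f) `^ r^-1 <= c -> (psum r f <= (c `^ r)%:E)%E.
    by move=> c0; rewrite (psum_fine_le r1 fr c0).
  have tE c : 0 <= c -> fine (psum r g) `^ r^-1 <= c -> (psum r g <= (c `^ r)%:E)%E.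
    by move=> c0; rewrite (psum_fine_le r1 gr c0).
  move: (fine (psum r f) `^ r^-1) (fine (psum r g) `^ r^-1) s0 t0 sE tE.
  move=> s t s0 t0 sE tE.
  have le1 (e : R) : 0 < e ->
      (psum r (fun x => (f x + g x)%R) <= ((s + e + (t + e)) `^ r)%:E)%E.
    move=> e0.
    have se0 : 0 < s + e by exact: ltr_wpDl.
    have te0 : 0 < t + e by exact: ltr_wpDl.
    apply: (psumD r1 se0 te0).
      by apply: sE; [exact: ltW|rewrite lerDl; exact: ltW].
    by apply: tE; [exact: ltW|rewrite lerDl; exact: ltW].
  have fgr : (psum r (fun x => (f x + g x)%R) < +oo)%E.
    by apply: le_lt_trans (le1 _ ltr01) _; rewrite ltry.
  split=> //; apply/ler_addgt0Pl => e e0.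
  have e20 : 0 < e / 2 by rewrite divr_gt0.
  have -> : e + (s + t) = s + e / 2 + (t + e / 2) by field.
  have ge0 : 0 <= s + e / 2 + (t + e / 2).
    by apply: addr_ge0; apply: addr_ge0 => //; exact: ltW.
  by rewrite (psum_fine_le r1 fgr ge0); exact: le1.
Qed.

Lemma lp0 p : lp_exponent p -> lp_mem p (cst 0) /\ lp_norm p (cst 0) = 0.
Proof.
have rc0 (x : X) : rnorm (cst 0 x : E) = 0 by exact: rnorm0.
suff : lp_exponent p -> lp_mem p (cst 0).
  move=> h hp; have m0 := h hp; split=> //; apply/eqP.
  rewrite eq_le lp_norm_ge0// andbT -[leRHS](mul0r (lp_norm p (cst 0))).
  by apply: (lp_dom hp m0 _ _ _).2 => // x; rewrite rc0 mulr0.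
elim/lp_exponent_ind => [|r r1 r0|]; rewrite /lp_mem/= ?eqxx.
- split=> [|e e0]; first exact: cst_continuous.
  by exists set0 => [|x _]; [exact: compact0|rewrite rc0].
- rewrite (negbTE r0) /psum esum1 ?ltry// => x _.
  by rewrite rc0 powR0.
- by apply/bounded_fun_rnorm; exists 0 => x; rewrite rc0.
Qed.

Lemma lp_norm_eq0 p f : lp_exponent p -> lp_mem p f -> lp_norm p f = 0 ->
  forall x, f x = 0.
Proof.
have sup0 f' : bounded_fun f' -> sup_norm f' = 0 -> forall x, f' x = 0.
  move=> bf f0 x; apply/rnorm0_eq0/eqP; rewrite eq_le rnorm_ge0 andbT -f0.
  exact: sup_norm_ub.
elim/lp_exponent_ind => [f0|r r1 r0 fr|]; last exact: sup0.
- by have := sup0 _ (c0_bounded f0); rewrite /lp_norm/= eqxx.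
move: fr; rewrite /lp_mem /lp_norm (negbTE r0) => fr f0 x.
have : (psum r f <= (0 `^ r)%:E)%E by rewrite -psum_fine_le// f0.
rewrite powR0// => f_le0; apply/rnorm0_eq0/eqP.
have : ((rnorm (f x) `^ r)%:E <= 0)%E.
  apply: le_trans f_le0; apply: esum_ge; exists [set x].
    by split; [exact: finite_set1|].
  by rewrite fsbig_set1.
rewrite lee_fin => fx0; have : rnorm (f x) `^ r == 0.
  by rewrite eq_le fx0 powR_ge0.
by rewrite powR_eq0 => /andP[].
Qed.

End lp_predicate.

Section lp_space.
Context {R : realType} {p : \bar R} (hp : lp_exponent p).
Variables (X : metricType R) (E : normedModType R[i]).

(* The proof argument makes the closure lemmas below usable as instances. *)
Definition lp_pred (_ : lp_exponent p) : {pred X -> E} :=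
  [pred f | `[< lp_mem p f >]].

Lemma lp_predP (f : X -> E) : reflect (lp_mem p f) (f \in lp_pred hp).
Proof. exact: asboolP. Qed.

Record lp := Lp { lp_fun :> X -> E ; lp_funP : lp_fun \in lp_pred hp }.

HB.instance Definition _ := [isSub for lp_fun].
HB.instance Definition _ := [Choice of lp by <:].

Lemma lp_memP (f : lp) : lp_mem p f.
Proof. exact/lp_predP/lp_funP. Qed.

Lemma continuous_scale (l : R[i]) (f : X -> E) :
  continuous f -> continuous (fun x => l *: f x).
Proof. by move=> cf x; apply: cvgZr; exact: cf. Qed.

Lemma lp_scale (l : R[i]) (f : X -> E) : lp_mem p f ->
  lp_mem p (fun x => l *: f x) /\
  lp_norm p (fun x => l *: f x) <= complex.Re `|l| * lp_norm p f.
Proof.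
move=> fp; apply: lp_dom => //.
- exact: (@rnorm_ge0 R R[i]^o l).
- exact: continuous_scale.
- by move=> x; rewrite rnormZ.
Qed.

Lemma lp_submod_closed : submod_closed (lp_pred hp).
Proof.
split=> [|l f g]; first exact/lp_predP/(lp0 hp).1.
move=> /lp_predP fp /lp_predP gp; apply/lp_predP.
exact: (lpD hp (lp_scale l fp).1 gp).1.
Qed.

HB.instance Definition _ := GRing.isSubmodClosed.Build _ _ (lp_pred hp)
  lp_submod_closed.

HB.instance Definition _ := [SubChoice_isSubLmodule of lp by <:].

Let nm (f : lp) : R[i] := (lp_norm p f)%:C.

Let nmD (f g : lp) : nm (f + g) <= nm f + nm g.
Proof.
by rewrite /nm -rmorphD lecR (lpD hp (lp_memP f) (lp_memP g)).2.
Qed.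

Let nmZ (l : R[i]) (f : lp) : nm (l *: f) = `|l| * nm f.
Proof.
have Rl (z : R[i]) : real_complex R (complex.Re `|z|) = `|z|.
  by rewrite RRe_real ?ger0_real.
have le1 (k : R[i]) (g : lp) : nm (k *: g) <= `|k| * nm g.
  by rewrite /nm -[in leRHS]Rl -rmorphM lecR (lp_scale k (lp_memP g)).2.
have [->|l0] := eqVneq l 0.
  rewrite scale0r normr0 mul0r /nm.
  by rewrite (_ : lp_norm _ _ = 0) ?rmorph0//; exact: (lp0 hp).2.
apply/eqP; rewrite eq_le le1/= -ler_pdivlMl ?normr_gt0// -normfV.
by rewrite -{1}(scalerK l0 f).
Qed.

Let nm0_eq0 (f : lp) : nm f = 0 -> f = 0.
Proof.
move=> [f0]; apply/val_inj/funext => x.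
exact: lp_norm_eq0 hp (lp_memP f) f0 x.
Qed.

HB.instance Definition _ := Lmodule_isNormed.Build R[i] lp nmD nmZ nm0_eq0.

Lemma lp_rnormE (f : lp) : rnorm f = lp_norm p f.
Proof. by []. Qed.

End lp_space.

Section bounded_operators.
Context {R : realType} (V : normedModType R[i]).

Definition bop_pred : {pred V -> V} :=
  [pred a | `[< linear a /\
                exists M : R, forall v, rnorm (a v) <= M * rnorm v >]].

Record bop := Bop { bop_fun :> V -> V ; bop_funP : bop_fun \in bop_pred }.

HB.instance Definition _ := [isSub for bop_fun].
HB.instance Definition _ := [Choice of bop by <:].

Lemma bop_linear (a : bop) : linear a.
Proof. by have /asboolP[] := bop_funP a. Qed.

HB.instance Definition _ (a : bop) :=
  GRing.isLinear.Build R[i] V V *:%R a (bop_linear a).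

Lemma bop_bounded (a : bop) :
  exists2 M : R, 0 <= M & forall v, rnorm (a v) <= M * rnorm v.
Proof.
have /asboolP[_ [M aM]] := bop_funP a.
exists (Num.max 0 M); first by rewrite le_max lexx.
by move=> v; rewrite (le_trans (aM v))// ler_wpM2r ?rnorm_ge0// le_max lexx orbT.
Qed.

Lemma bop_submod_closed : submod_closed bop_pred.
Proof.
split=> [|l a b].
  apply/asboolP; split=> [k v w|]; first by rewrite scaler0 addr0.
  by exists 0 => v; rewrite rnorm0 mul0r.
move=> ha hb; have [M M0 aM] := bop_bounded (Bop ha).
have [N N0 bN] := bop_bounded (Bop hb).
have la : linear a by exact: bop_linear (Bop ha).
have lb : linear b by exact: bop_linear (Bop hb).
apply/asboolP; split=> [k v w|].
  rewrite !fctE la lb !scalerDr !scalerA [l * k]mulrC.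
  by rewrite addrACA.
exists (complex.Re `|l| * M + N) => v.
rewrite (le_trans (ler_rnormD _ _))// rnormZ mulrDl lerD ?bN// -mulrA.
by rewrite ler_wpM2l ?aM//; exact: (@rnorm_ge0 R R[i]^o l).
Qed.

HB.instance Definition _ := GRing.isSubmodClosed.Build _ _ bop_pred
  bop_submod_closed.

HB.instance Definition _ := [SubChoice_isSubLmodule of bop by <:].

Definition op_norm (a : bop) : R :=
  sup [set rnorm (a v) | v in [set v : V | rnorm v <= 1]].

Lemma op_norm_le (a : bop) (c : R) :
  (forall v, rnorm v <= 1 -> rnorm (a v) <= c) -> op_norm a <= c.
Proof.
move=> ac; apply: ge_sup => [|_ [v v1 <-]]; last exact: ac.
by exists (rnorm (a 0)), 0 => //=; rewrite rnorm0.
Qed.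

Lemma op_norm_ub1 (a : bop) v : rnorm v <= 1 -> rnorm (a v) <= op_norm a.
Proof.
move=> v1; apply: ub_le_sup; last by exists v.
have [M M0 aM] := bop_bounded a.
exists M => _ [w w1 <-]; rewrite (le_trans (aM w))//.
by rewrite -[leRHS]mulr1 ler_wpM2l.
Qed.

Lemma op_norm_ge0 (a : bop) : 0 <= op_norm a.
Proof. by apply: le_trans (op_norm_ub1 a (v := 0) _); rewrite ?rnorm_ge0 ?rnorm0. Qed.

Lemma op_norm_ub (a : bop) v : rnorm (a v) <= op_norm a * rnorm v.
Proof.
have [v0|v0] := eqVneq (rnorm v) 0.
  by rewrite (rnorm0_eq0 v0) linear0 rnorm0 mulr0.
have v_gt0 : 0 < rnorm v by rewrite lt_neqAle eq_sym v0 rnorm_ge0.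
pose k : R[i] := ((rnorm v)^-1)%:C.
have k0 : 0 <= k by rewrite ler0c invr_ge0 rnorm_ge0.
have kE : complex.Re `|k| = (rnorm v)^-1 by rewrite ger0_norm.
have : rnorm (a (k *: v)) <= op_norm a.
  by apply: op_norm_ub1; rewrite rnormZ kE mulVf.
by rewrite linearZ rnormZ kE ler_pdivrMl// mulrC.
Qed.

Let nm (a : bop) : R[i] := (op_norm a)%:C.

Let nmD (a b : bop) : nm (a + b) <= nm a + nm b.
Proof.
rewrite /nm -rmorphD lecR; apply: op_norm_le => v v1.
by rewrite (le_trans (ler_rnormD _ _))// lerD ?op_norm_ub1.
Qed.

Let nmZ (l : R[i]) (a : bop) : nm (l *: a) = `|l| * nm a.
Proof.
have Rl (z : R[i]) : real_complex R (complex.Re `|z|) = `|z|.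
  by rewrite RRe_real ?ger0_real.
have le1 (k : R[i]) (b : bop) : nm (k *: b) <= `|k| * nm b.
  rewrite /nm -[in leRHS]Rl -rmorphM lecR; apply: op_norm_le => v v1.
  by rewrite rnormZ ler_wpM2l ?op_norm_ub1//; exact: (@rnorm_ge0 R R[i]^o k).
have [->|l0] := eqVneq l 0.
  apply/eqP; rewrite normr0 mul0r eq_le; apply/andP; split.
    by rewrite (le_trans (le1 _ _))// normr0 mul0r.
  by rewrite ler0c op_norm_ge0.
apply/eqP; rewrite eq_le le1/= -ler_pdivlMl ?normr_gt0// -normfV.
by rewrite -{1}(scalerK l0 a).
Qed.

Let nm0_eq0 (a : bop) : nm a = 0 -> a = 0.
Proof.
move=> [a0]; apply/val_inj/funext => v; apply/rnorm0_eq0/eqP.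
by rewrite eq_le rnorm_ge0 andbT (le_trans (op_norm_ub a v))// a0 mul0r.
Qed.

HB.instance Definition _ := Lmodule_isNormed.Build R[i] bop nmD nmZ nm0_eq0.

Lemma bop_rnormE (a : bop) : rnorm a = op_norm a.
Proof. by []. Qed.

Definition closed_under_inverses (A : set bop) : Prop :=
  forall a b : bop, A a -> cancel a b -> cancel b a -> A b.

End bounded_operators.

Section metric_geometry.
Context {R : realType} (X : metricType R).

Definition bounded_geometry : Prop :=
  forall r : R, 0 <= r ->
    exists N : nat, forall x : X, ([set y | mdist x y <= r] #<= `I_N)%card.

Definition strongly_discrete : Prop :=
  let D : set R := [set r | exists x y : X, r = mdist x y] in
  D `<=` isolated D.

(* [+oo] as soon as one of the two sets is empty. *)
Definition set_dist (A B : set X) : \bar R :=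
  ereal_inf [set (mdist x y)%:E | x in A & y in B].

Definition supp (V : nmodType) (f : X -> V) : set X :=
  closure [set x | f x != 0].

Definition metric_partition_of_unity (q : R) (I : choiceType)
    (phi : I -> X -> R) : Prop :=
  [/\ forall i x, 0 <= phi i x <= 1,
      exists D : R, forall i x y,
        supp (phi i) x -> supp (phi i) y -> mdist x y <= D,
      exists M : nat, forall x, ([set i | supp (phi i) x] #<= `I_M)%card &
      forall x, (\esum_(i in [set: I]) (phi i x `^ q)%:E)%E = 1%:E].

Definition has_variation (q r e : R) (I : choiceType) (phi : I -> X -> R) :
    Prop :=
  forall x y, mdist x y <= r ->
    (\esum_(i in [set: I]) (`|phi i x - phi i y| `^ q)%:E < (e `^ q)%:E)%E.

(* The condition on [q] is independent of [q] in [1, +oo[, so that requiring it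
   for some [q] is the same as requiring it for a fixed or for every [q]. *)
Definition property_A : Prop :=
  exists2 q : R, 1 <= q &
    forall r e : R, 0 < r -> 0 < e ->
      exists (I : choiceType) (phi : I -> X -> R),
        metric_partition_of_unity q phi /\ has_variation q r e phi.

Record Cb := MkCb {
  Cb_fun :> X -> R[i]^o ;
  Cb_continuous : continuous Cb_fun ;
  Cb_bounded : bounded_fun Cb_fun }.

End metric_geometry.

Section multiplication.
Context {R : realType} {p : \bar R} {hp : lp_exponent p}.
Context {X : metricType R} {E : normedModType R[i]}.

Lemma Cb_mul_subproof (f : Cb X) (xi : lp hp X E) :
  (fun x => f x *: xi x) \in lp_pred hp.
Proof.
apply/lp_predP; have /bounded_fun_rnorm[M fM] := Cb_bounded f.
apply: (lp_dom (M := Num.max 0 M) hp (lp_memP xi) _ _ _).1.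
- by rewrite le_max lexx.
- by move=> cxi x; apply: cvgZ; [exact: Cb_continuous|exact: cxi].
- move=> x; rewrite rnormZ ler_wpM2r ?rnorm_ge0//.
  by rewrite le_max; apply/orP; right; exact: fM.
Qed.

Definition Cb_mul (f : Cb X) (xi : lp hp X E) : lp hp X E :=
  Lp (Cb_mul_subproof f xi).

Definition finite_propagation (a : bop (lp hp X E)) : Prop :=
  exists2 r : R, 0 <= r &
    forall f f' : Cb X, (r%:E < set_dist (supp f) (supp f'))%E ->
      forall xi, Cb_mul f (a (Cb_mul f' xi)) = 0.

End multiplication.

(* The topology of [bop _] is the one of the operator norm. *)
Definition band_dominated (R : realType) (p : \bar R) (hp : lp_exponent p)
    (X : metricType R) (E : normedModType R[i]) : set (bop (lp hp X E)) :=
  closure [set a | finite_propagation a].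

Definition uniform_roe (R : realType) (p : \bar R) (hp : lp_exponent p)
    (X : metricType R) : set (bop (lp hp X R[i]^o)) :=
  closure [set a | finite_propagation a].

Arguments band_dominated {R p} hp X E.
Arguments uniform_roe {R p} hp X.

(* Main.v *)
Require Import Defs.
From mathcomp Require Import all_boot all_order all_algebra finmap.
From mathcomp.real_closed Require Import complex.
From mathcomp Require Import all_classical all_reals all_analysis.
From mathcomp Require Import ring lra.

Set Implicit Arguments.
Unset Strict Implicit.
Unset Printing Implicit Defensive.

Import Order.TTheory GRing.Theory Num.Theory.
Import numFieldNormedType.Exports.

Local Open Scope classical_set_scope.
Local Open Scope ring_scope.
Local Open Scope complex_scope.

(** Let [a] be band-dominated with inverse [b]. Multiplication operators almost
    commute with [a] when they vary slowly: a finite propagation operator is a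
    band matrix, so that [g a - a g] has entries [(g x - g y) a_xy] with
    [d x y <= rho], and the number of entries per row and column is bounded
    because balls are uniformly finite. The identity

      [b g - g b = b (g a - a g) b]

    transfers this to the inverse. What remains is to cut [b] into pieces of
    bounded width by means of slowly varying functions, with an error controlled
    by the commutators only. How to cut depends on the exponent.

    - For exponents [0] and [+oo] the norm is a supremum over rows: replace the
      row of [b] at [x] by that of [b f_x], where [f_x] is a tent of height 1
      centred at [x]. Since [f_x x = 1], the error at [x] is the value there of
      a commutator ([sup_inverse_closed]).
    - For exponent [1] the norm is a supremum over columns: the same is done with
      columns, multiplying the one at [y] by [f_y]. The comparison is made on
      finitely supported functions, which are dense ([l1_inverse_closed]).
    - For [1 < r < +oo] Property A gives a partition of unity
      [sum_i phi_i ^ r = 1] of small [r]-variation, and [b] is approximated by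
      [sum_i phi_i ^ (r - 1) b phi_i]. By Holder, the norm of a sum
      [sum_i phi_i ^ (r - 1) u_i] is at most [(sum_i |u_i| ^ r) ^ (1 / r)], and
      the error is such a sum with [u_i] the commutator of [b] and [phi_i]
      ([lr_inverse_closed]). *)

(** * Inequalities between real powers *)

Section powers.
Context {R : realType}.
Implicit Types (p q r s t u v : R).

Lemma powR_invK r t : 0 < r -> 0 <= t -> (t `^ r^-1) `^ r = t.
Proof. by move=> r0 t0; rewrite -powRrM mulVf ?gt_eqF// powRr1. Qed.

Lemma powR_powK r t : 0 < r -> 0 <= t -> (t `^ r) `^ r^-1 = t.
Proof. by move=> r0 t0; rewrite -powRrM divff ?gt_eqF// powRr1. Qed.

(** Each summand is at most the [r]-th root of the sum of the [r]-th powers.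
    For a band matrix it is enough that the constant depends on the number of
    terms only. *)
Lemma powR_sum_le (I : eqType) (l : seq I) (c : I -> R) r : 0 < r ->
  (forall i, 0 <= c i) ->
  (\sum_(i <- l) c i) `^ r <= (size l)%:R `^ r * \sum_(i <- l) c i `^ r.
Proof.
move=> r0 c0; set S := \sum_(i <- l) c i `^ r.
have S0 : 0 <= S by apply: sumr_ge0 => i _; rewrite powR_ge0.
rewrite -[in leRHS](powR_invK r0 S0) -powRM ?powR_ge0//.
rewrite ge0_ler_powR ?(ltW r0) ?nnegrE ?sumr_ge0 ?mulr_ge0 ?powR_ge0//.
have -> : (size l)%:R * S `^ r^-1 = \sum_(i <- l) S `^ r^-1.
  by rewrite big_const_seq count_predT iter_addr_0 mulr_natl.
rewrite big_seq [leRHS]big_seq; apply: ler_sum => i il.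
rewrite -[leLHS](powR_powK r0 (c0 i)).
rewrite ge0_ler_powR ?nnegrE ?powR_ge0 ?invr_ge0 ?(ltW r0)//.
rewrite /S (big_rem i)//= lerDl.
by apply: sumr_ge0 => j _; rewrite powR_ge0.
Qed.

Lemma powR_add3_le r u v w :
  0 < r -> 0 <= u -> 0 <= v -> 0 <= w ->
  (u + v + w) `^ r <= 3 `^ r * (u `^ r + v `^ r + w `^ r).
Proof.
move=> r0 u0 v0 w0.
have c0 (i : nat) : 0 <= nth 0 [:: u; v; w] i.
  by case: i => [|[|[|i]]] //=; rewrite nth_nil.
have := @powR_sum_le _ (iota 0 3) _ r r0 c0.
rewrite /= big_cons big_cons big_cons big_nil/=.
rewrite big_cons big_cons big_cons big_nil/=.
by rewrite addr0 addr0 addrA addrA.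
Qed.

(** Holder's inequality for the functions [phi ^ (p - 1)] and [t], whose
    first factor has conjugate norm at most 1: the exponent conjugate to [p]
    is [p / (p - 1)]. This is what makes the blocks
    [phi_i ^ (p - 1) b phi_i] sum up to a bounded operator. It is
    obtained by summing Young's inequality after normalizing [t]. *)
Lemma holder_sum_powR (I : eqType) (l : seq I) (phi t : I -> R) p : 1 <= p ->
  (forall i, 0 <= phi i) -> (forall i, 0 <= t i) ->
  \sum_(i <- l) phi i `^ p <= 1 ->
  (\sum_(i <- l) phi i `^ (p - 1) * t i) `^ p <= \sum_(i <- l) t i `^ p.
Proof.
move=> p1 phi0 t0 phi1.
have p0 : 0 < p by exact: lt_le_trans p1.
set S := \sum_(i <- l) t i `^ p.
have S0 : 0 <= S by apply: sumr_ge0 => i _; rewrite powR_ge0.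
rewrite -[leRHS](powR_invK p0 S0).
rewrite ge0_ler_powR ?(ltW p0) ?nnegrE ?powR_ge0//.
  by apply: sumr_ge0 => i _; rewrite mulr_ge0 ?powR_ge0.
have [Sz|Sn0] := eqVneq S 0.
  rewrite big_seq big1 ?powR_ge0// => i il.
  suff -> : t i = 0 by rewrite mulr0.
  apply: (@powR_eq0_eq0 _ _ p); apply/eqP; rewrite eq_le powR_ge0 andbT -Sz.
  by rewrite /S (big_rem i)//= lerDl sumr_ge0// => j _; rewrite powR_ge0.
have Sp : 0 < S `^ p^-1 by rewrite powR_gt0// lt_neqAle eq_sym Sn0.
have [pE|pn1] := eqVneq p 1.
  have -> : S `^ p^-1 = S by rewrite pE invr1 powRr1.
  rewrite /S pE.
  by apply: ler_sum => i _; rewrite subrr powRr0 mul1r powRr1.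
have pm1 : 0 < p - 1 by rewrite subr_gt0 lt_neqAle eq_sym pn1.
pose q := p / (p - 1).
have q0 : 0 < q by rewrite divr_gt0.
have pq : q^-1 + p^-1 = 1 by rewrite /q; field; rewrite !gt_eqF.
rewrite -[leRHS]mul1r -ler_pdivrMr// mulr_suml.
have SV : (S `^ p^-1)^-1 `^ p = S^-1.
  by rewrite -powR_inv1 ?powR_ge0// powRAC powR_invK// powR_inv1.
apply: (@le_trans _ _ (\sum_(i <- l) (phi i `^ p / q + t i `^ p / S / p))).
  apply: ler_sum => i _; rewrite -[leLHS]mulrA.
  have tS : 0 <= t i / S `^ p^-1 by rewrite divr_ge0// powR_ge0.
  apply: le_trans (conjugate_powR (powR_ge0 _ _) tS q0 p0 pq) _.
  rewrite -powRrM (_ : (p - 1) * q = p); last by rewrite mulrC divfK ?gt_eqF.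
  by rewrite powRM ?invr_ge0 ?powR_ge0// SV.
rewrite big_split/= -!mulr_suml divff// mul1r -[leRHS]pq lerD2r.
by rewrite -[leRHS]mul1r ler_wpM2r// invr_ge0 ltW.
Qed.

(** Write [w ^ p] as [w * w ^ (p - 1)] and use that the second factor
    is nondecreasing. *)
Lemma powR_superadditive p u v : 1 <= p -> 0 <= u -> 0 <= v ->
  u `^ p + v `^ p <= (u + v) `^ p.
Proof.
move=> p1 u0 v0; have p0 : 0 < p by exact: lt_le_trans p1.
have e w : 0 <= w -> w `^ p = w * w `^ (p - 1) by move=> w0; rewrite mulr_powRB1.
rewrite !e ?addr_ge0// mulrDl.
have pm : 0 <= p - 1 by rewrite subr_ge0.
by apply: lerD; apply: ler_wpM2l => //; rewrite ge0_ler_powR ?nnegrE ?(addr_ge0 u0 v0) ?lerDl ?lerDr.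
Qed.

Lemma powR_inv_dist p s t : 1 <= p -> 0 <= s -> 0 <= t ->
  `|s `^ p^-1 - t `^ p^-1| `^ p <= `|s - t|.
Proof.
move=> p1; wlog ts : s t / t <= s.
  move=> h s0 t0; have [ts|/ltW st] := leP t s; first exact: h.
  by rewrite distrC [leRHS]distrC; exact: h.
move=> s0 t0; have p0 : 0 < p by exact: lt_le_trans p1.
have le1 : t `^ p^-1 <= s `^ p^-1.
  by rewrite ge0_ler_powR ?nnegrE// invr_ge0 ltW.
rewrite !ger0_norm ?subr_ge0//.
have := @powR_superadditive p (s `^ p^-1 - t `^ p^-1) (t `^ p^-1) p1.
rewrite subr_ge0 => /(_ le1 (powR_ge0 _ _)).
by rewrite subrK !powR_invK// lerBrDr.
Qed.

(** By convexity, [(t + u) ^ q <= (1 + d) t ^ q + C u ^ q] for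
    a suitable [C]. Together with [powR_inv_dist] this compares the variations
    of a partition of unity for two different exponents. *)
Lemma powR_dist q d : 1 <= q -> 0 < d ->
  exists2 C : R, 0 <= C & forall s t, 0 <= s -> 0 <= t ->
    `|s `^ q - t `^ q| <= d * (s `^ q + t `^ q) + C * `|s - t| `^ q.
Proof.
move=> q1 d0; have q0 : 0 < q by exact: lt_le_trans q1.
(* Weights [1] and [tau] such that [(1 + tau) ^ q = 1 + d]. *)
pose w := (1 + d) `^ q^-1; pose tau := w - 1.
have d1 : 0 <= 1 + d by rewrite addr_ge0// ltW.
have wE : w `^ q = 1 + d by rewrite powR_invK.
have w1 : 1 < w.
  rewrite ltNge; apply/negP => w1.
  have w0 : 0 <= w by exact: powR_ge0.
  have : w `^ q <= 1 `^ q by rewrite ge0_ler_powR ?nnegrE ?(ltW q0).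
  by rewrite wE powR1; lra.
have w0 : 0 < w := lt_trans ltr01 w1.
have tau0 : 0 < tau by rewrite subr_gt0.
pose C := (1 + d) * (tau / w) * tau^-1 `^ q.
have C0 : 0 <= C.
  rewrite /C; apply: mulr_ge0; last exact: powR_ge0.
  by apply: mulr_ge0 => //; exact: divr_ge0 (ltW tau0) (ltW w0).
exists C => // s t; wlog ts : s t / t <= s.
  move=> h s0 t0; have [ts|/ltW st] := leP t s; first exact: h.
  by rewrite distrC (distrC s) (addrC (s `^ q)); exact: h.
move=> s0 t0; rewrite ger0_norm ?subr_ge0 ?ge0_ler_powR ?nnegrE ?(ltW q0)//.
have st : 0 <= s - t by rewrite subr_ge0.
rewrite (ger0_norm st).
(* Convexity is applied to the decomposition [s = t + (s - t)]. *)
have := powRD_convex q1 ltr01 tau0 t0 st.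
rewrite addrC subrK (_ : 1 + tau = w); last by rewrite addrC subrK.
rewrite wE divr1 powRM ?invr_ge0 ?(ltW tau0)// -!/(C).
have -> : (1 + d) * (tau / w) * ((s - t) `^ q * tau^-1 `^ q) = C * (s - t) `^ q.
  by rewrite /C; ring.
have h : (1 + d) * (1 / w) * t `^ q <= (1 + d) * t `^ q.
  rewrite ler_wpM2r ?powR_ge0// -[leRHS]mulr1 ler_wpM2l//.
  by rewrite div1r invf_le1// ltW.
have := powR_ge0 s q; move: h; set c := C * _; set S := s `^ q; set T := t `^ q.
move: (_ * _ * T) => z.
have dS : 0 <= d * S by rewrite mulr_ge0 ?powR_ge0 ?ltW.
by lra.
Qed.

End powers.

(** * Unordered sums *)

Section sums.
Context {R : realType}.

Lemma exchange_esum (T1 T2 : choiceType) (a : T1 -> T2 -> \bar R) :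
  (forall i j, 0 <= a i j)%E ->
  (\esum_(i in [set: T1]) \esum_(j in [set: T2]) a i j =
   \esum_(j in [set: T2]) \esum_(i in [set: T1]) a i j)%E.
Proof.
move=> a0; rewrite !esum_esum//.
pose e (k : T1 * T2) := (k.2, k.1).
rewrite [RHS](@reindex_esum _ _ _ ([set: T1] `*`` (fun=> [set: T2])) _ e)//.
split=> //= [[i j] [i' j'] _ _ [-> ->]//|[j i] _].
by exists (i, j).
Qed.

(** Turns a finite sum into an unordered sum over the whole type, so that it
    can be exchanged with another unordered sum. *)
Lemma esum_mkfset (T : choiceType) (F : {fset T}) (g : T -> R) :
  (forall y, 0 <= g y) ->
  (\esum_(y in [set: T]) (if y \in F then g y else 0)%:E =
   (\sum_(y <- F) g y)%:E)%E.
Proof.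
move=> g0.
under eq_esum do rewrite (fun_if EFin).
transitivity (\esum_(y in [set` F]) (g y)%:E)%E.
  by rewrite [RHS]esum_mkcond; apply: eq_esum => y _; rewrite mem_setE.
rewrite esum_fset//; last by move=> i _; rewrite lee_fin.
by rewrite -sumEFin fsbig_finite//= set_fsetK.
Qed.

Lemma sum_fset_le_esum (T : choiceType) (F : {fset T}) (g : T -> R) :
  (forall y, 0 <= g y) ->
  ((\sum_(y <- F) g y)%:E <= \esum_(y in [set: T]) (g y)%:E)%E.
Proof.
move=> g0; rewrite -esum_mkfset//; apply: le_esum => y _.
by rewrite lee_fin; case: ifP.
Qed.

Lemma esum_finsupp (T : choiceType) (F : {fset T}) (g : T -> R) :
  (forall y, 0 <= g y) -> (forall y, y \notin F -> g y = 0) ->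
  (\esum_(y in [set: T]) (g y)%:E = (\sum_(y <- F) g y)%:E)%E.
Proof.
move=> g0 gF; rewrite -esum_mkfset//; apply: eq_esum => y _.
by case: ifPn => // /gF ->.
Qed.

Lemma esum_add3_le (T : choiceType) k (a b c : T -> R) : 0 <= k ->
  (forall i, 0 <= a i) -> (forall i, 0 <= b i) -> (forall i, 0 <= c i) ->
  (\esum_(i in [set: T]) (k * (a i + b i + c i))%:E <= k%:E *
    (\esum_(i in [set: T]) (a i)%:E + \esum_(i in [set: T]) (b i)%:E +
     \esum_(i in [set: T]) (c i)%:E))%E.
Proof.
move=> k0 a0 b0 c0; apply: le_trans (esumZ_le k0 _) _.
  by move=> i; rewrite !addr_ge0.
under eq_esum do rewrite !EFinD.
by rewrite !esumD// => i _; rewrite ?adde_ge0 ?lee_fin ?a0 ?b0 ?c0.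
Qed.

Lemma esum_unit (g : unit -> \bar R) : (0 <= g tt)%E ->
  (\esum_(y in [set: unit]) g y = g tt)%E.
Proof.
move=> g0; rewrite (_ : [set: unit] = [set tt]) ?esum_set1//.
by apply/seteqP; split=> -[].
Qed.

End sums.

(** * Discreteness and counting in bounded geometry *)

Section geometry.
Context {R : realType} (X : metricType R).
Hypothesis bgX : bounded_geometry X.

Lemma finite_ball (x : X) r : finite_set [set y | mdist x y <= r].
Proof.
have [N NX] := bgX (normr_ge0 r).
apply: (@sub_finite_set _ _ [set y | mdist x y <= `|r|]).
  by move=> y /= /le_trans; apply; exact: ler_norm.
by have /card_le_finite := NX x; apply.
Qed.

Definition fball (x : X) (r : R) : {fset X} :=
  fset_set [set y | mdist x y <= r].

Lemma in_fball x y r : (y \in fball x r) = (mdist x y <= r).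
Proof.
rewrite /fball in_fset_set; last exact: finite_ball.
by apply/idP/idP; rewrite inE.
Qed.

Lemma in_fballC x y r : (y \in fball x r) = (x \in fball y r).
Proof. by rewrite !in_fball metric_sym. Qed.

Lemma size_fball r : 0 <= r ->
  exists N : nat, forall x : X, (size (fball x r) <= N)%N.
Proof.
by move=> /bgX[N NX]; exists N => x; exact: (geq_card_fset_set (NX x)).
Qed.

(** The Schur test: after exchanging the sums, [g y] is counted once for
    every point whose ball contains [y], that is, for every point of the ball
    at [y]. *)
Lemma schur_esum (N : nat) r (g : X -> R) :
  (forall x : X, (size (fball x r) <= N)%N) -> (forall y, 0 <= g y) ->
  (\esum_(x in [set: X]) (\sum_(y <- fball x r) g y)%:E <=
   N%:R%:E * \esum_(y in [set: X]) (g y)%:E)%E.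
Proof.
move=> sN g0; under eq_esum do rewrite -esum_mkfset//.
rewrite exchange_esum; last by move=> i j; rewrite lee_fin; case: ifP.
apply: le_trans (esumZ_le _ _) => //; apply: le_esum => y _.
under eq_esum do rewrite in_fballC.
rewrite (@esum_mkfset _ _ (fball y r) (fun=> g y))// lee_fin.
rewrite big_const_seq count_predT iter_addr_0 -[_ *+ size _]mulr_natl.
by rewrite ler_wpM2r// ler_nat.
Qed.

(** The ball of radius 1 at [x] is finite, so removing its other points leaves
    a neighbourhood of [x]. *)
Lemma discrete_open (A : set X) : open A.
Proof.
rewrite openE => x Ax.
pose F := [set y | mdist x y <= 1] `\ x.
have cF : closed F.
  have /accessible_finite_set_closed := hausdorff_accessible (@metric_hausdorff _ X).
  by apply; exact: finite_setD (finite_ball x 1).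
apply: (filterS _ (filterI (nbhsx_ballx x _ (ltr01 : 0 < 1)) _)); last first.
  apply: open_nbhs_nbhs; split; first exact: (closed_openC cF).
  by move=> [_]; apply.
move=> y []; rewrite ballEmdist/= => xy nF.
have [->//|/eqP yx] := eqVneq y x.
by exfalso; apply: nF; split; [exact: ltW|].
Qed.

Lemma discrete_continuous (V : topologicalType) (f : X -> V) : continuous f.
Proof. by apply/continuousP => A _; exact: discrete_open. Qed.

Lemma discrete_suppE (V : nmodType) (f : X -> V) x : supp f x = (f x != 0).
Proof.
rewrite /supp (_ : closure _ = [set x | f x != 0])//.
apply/esym/closure_id; rewrite -openC; exact: discrete_open.
Qed.

(** Every point [x] has a neighbourhood contained in a fixed ball at [x0] of
    large enough radius, so compactness puts [K] in a single ball. *)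
Lemma discrete_compact (K : set X) : compact K -> finite_set K.
Proof.
move=> /compact_near_coveringP cK.
have [->|/set0P[x0 _]] := eqVneq K set0; first exact: finite_set0.
have : \forall r \near +oo%R, K `<=` (fun x : X => mdist x0 x <= r).
  apply: cK => x _; exists ([set x], [set r : R | mdist x0 x <= r]) => /=.
    split; last exact: nbhs_pinfty_ge (num_real _).
    by apply: open_nbhs_nbhs; split=> //; exact: discrete_open.
  by move=> [_ r] /= [->].
move=> /(@filter_ex _ _ _)[r Kr].
exact: sub_finite_set Kr (finite_ball x0 r).
Qed.

End geometry.

(** * Approximation in the operator norm *)

Section operators.
Context {R : realType} {V : normedModType R[i]}.

Lemma rnormN (v : V) : rnorm (- v) = rnorm v.
Proof. by rewrite /rnorm normrN. Qed.

Lemma rnormB (v w : V) : rnorm (v - w) = rnorm (w - v).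
Proof. by rewrite -rnormN opprB. Qed.

Lemma rnormZr (l : R) (v : V) : rnorm (l%:C *: v) = `|l| * rnorm v.
Proof. by rewrite rnormZ normc_def/= expr0n addr0 sqrtr_sqr. Qed.

Lemma rnorm_sum (I : Type) (l : seq I) (F : I -> V) :
  rnorm (\sum_(i <- l) F i) <= \sum_(i <- l) rnorm (F i).
Proof.
elim/big_ind2 : _ => [|v r w s vr ws|//]; first by rewrite rnorm0.
exact: le_trans (ler_rnormD _ _) (lerD vr ws).
Qed.

Lemma bop_pred_of (F : V -> V) (M : R) : linear F ->
  (forall v, rnorm (F v) <= M * rnorm v) -> F \in @bop_pred R V.
Proof. by move=> lF FM; apply/asboolP; split=> //; exists M. Qed.

(** Replaces neighbourhoods for the complex-valued norm of operators by real
    estimates at each vector, the form in which they are obtained below. *)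
Lemma closure_bopP (A : set (bop V)) (b : bop V) :
  closure A b <-> forall e : R, 0 < e ->
    exists2 c, A c & forall v, rnorm (c v - b v) <= e * rnorm v.
Proof.
split=> [Ab e e0|h B].
  have e0' : 0 < e%:C by rewrite ltcR.
  have [c [Ac]] := Ab _ (nbhsx_ballx b _ e0').
  rewrite -ball_normE /ball_/= => bc; exists c => // v.
  rewrite rnormB.
  apply: le_trans (op_norm_ub (b - c) v) _; rewrite ler_wpM2r ?rnorm_ge0//.
  by rewrite -bop_rnormE ltW// -ltcR -rnormE.
move=> /nbhs_ballP[e /= e0 eB].
have eE : e = (complex.Re e)%:C by rewrite RRe_real// gtr0_real.
have e0' : 0 < complex.Re e / 2 by rewrite divr_gt0// -ltcR -eE.
have [c Ac cb] := h _ e0'; exists c; split=> //; apply: eB.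
rewrite -ball_normE /ball_/= rnormE eE ltcR.
apply: (@le_lt_trans _ _ (complex.Re e / 2)); last first.
  by rewrite ltr_pdivrMr// mulr_natr mulr2n ltrDl -ltcR -eE.
rewrite bop_rnormE; apply: op_norm_le => v v1.
have -> : (b - c) v = - (c v - b v) by rewrite opprB.
rewrite rnormN (le_trans (cb v))//.
by rewrite -[leRHS]mulr1 ler_wpM2l// ltW.
Qed.

End operators.

(** * Elements of the sequence spaces and multiplication operators *)

Section lp_values.
Context {R : realType} {X : metricType R} {E : normedModType R[i]}.
Implicit Types (f : X -> E) (p : \bar R).

Lemma lp_mem_eval_le p f x : lp_exponent p -> lp_mem p f ->
  rnorm (f x) <= lp_norm p f.
Proof.
elim/(@lp_exponent_ind R) => [f0|r r1 r0 fr|].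
- by rewrite /lp_norm/= eqxx; exact/sup_norm_ub/c0_bounded.
- have rp : 0 < r by exact: lt_le_trans r1.
  move: fr; rewrite /lp_mem /lp_norm (negbTE r0) => fr.
  have p0 := psum_ge0 r f.
  rewrite -[leLHS](powR_powK rp (rnorm_ge0 _)).
  rewrite ge0_ler_powR ?nnegrE ?powR_ge0 ?invr_ge0 ?(ltW rp) ?fine_ge0//.
  rewrite -lee_fin fineK ?ge0_fin_numE//.
  have := @sum_fset_le_esum R X [fset x]%fset (fun x => rnorm (f x) `^ r).
  by rewrite big_seq_fset1; apply => y; exact: powR_ge0.
- exact: sup_norm_ub.
Qed.

(* an element supported at a point *)
Lemma lp_norm_point p f y : lp_exponent p -> (forall x, x != y -> f x = 0) ->
  lp_mem p f -> lp_norm p f <= rnorm (f y).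
Proof.
move=> + fy; have fs : sup_norm f <= rnorm (f y).
  apply: sup_norm_le; first exact: rnorm_ge0.
  move=> x; have [->//|/fy ->] := eqVneq x y.
  by rewrite rnorm0 rnorm_ge0.
elim/(@lp_exponent_ind R) => [f0|r r1 r0 fr|//].
  by rewrite /lp_norm/= eqxx.
have rp : 0 < r by exact: lt_le_trans r1.
move: fr; rewrite /lp_mem /lp_norm (negbTE r0) => fr.
rewrite psum_fine_le ?rnorm_ge0// /psum.
rewrite (@esum_finsupp _ _ [fset y]%fset); first by rewrite big_seq_fset1.
  by move=> x; exact: powR_ge0.
by move=> x; rewrite inE => /fy ->; rewrite rnorm0 powR0.
Qed.

End lp_values.

Section lp_elements.
Context {R : realType} {X : metricType R} {p : \bar R} {hp : lp_exponent p}.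
Context {E : normedModType R[i]}.
Hypothesis bgX : bounded_geometry X.
Local Notation L := (lp hp X E).

(** A total constructor, with default value 0, so that elements can be written
    before the proof of membership is known. *)
Definition mklp (f : X -> E) : L := insubd (0 : L) f.

Lemma mklpE (f : X -> E) : lp_mem p f -> mklp f = f :> (X -> E).
Proof. by move=> fp; rewrite /mklp insubdK//; exact/lp_predP. Qed.

Lemma lp_eqP (f g : L) : (forall x, f x = g x) -> f = g.
Proof. by move=> fg; apply/val_inj/funext. Qed.

Lemma lp_addE (f g : L) x : (f + g) x = f x + g x. Proof. by []. Qed.
Lemma lp_subE (f g : L) x : (f - g) x = f x - g x. Proof. by []. Qed.
Lemma lp_scaleE l (f : L) x : (l *: f) x = l *: f x. Proof. by []. Qed.
Lemma lp_zeroE x : (0 : L) x = 0. Proof. by []. Qed.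

Lemma lp_sumE (I : Type) (l : seq I) (F : I -> L) x :
  (\sum_(i <- l) F i) x = \sum_(i <- l) F i x.
Proof. by elim/big_ind2 : _ => // f v g w <- <-. Qed.

Lemma lp_eval_le (f : L) x : rnorm (f x) <= rnorm f.
Proof. exact: lp_mem_eval_le (lp_memP f). Qed.

Lemma lp_mem_dom (f : L) (g : X -> E) (M : R) : 0 <= M ->
  (forall x, rnorm (g x) <= M * rnorm (f x)) ->
  lp_mem p g /\ lp_norm p g <= M * rnorm f.
Proof.
move=> M0 fg; rewrite lp_rnormE; apply: lp_dom => //; first exact: lp_memP.
by move=> _; exact: discrete_continuous.
Qed.

Definition mulx (g : X -> R) (f : L) : L := mklp (fun x => (g x)%:C *: f x).

Lemma mulx_mem (g : X -> R) (f : L) : (forall x, `|g x| <= 1) ->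
  lp_mem p (fun x => (g x)%:C *: f x) /\
  lp_norm p (fun x => (g x)%:C *: f x) <= 1 * rnorm f.
Proof.
move=> g1; apply: lp_mem_dom => // x.
by rewrite rnormZr ler_wpM2r// rnorm_ge0.
Qed.

Lemma mulxE (g : X -> R) f x : (forall x, `|g x| <= 1) ->
  mulx g f x = (g x)%:C *: f x.
Proof. by move=> /(mulx_mem f)[gf _]; rewrite /mulx mklpE. Qed.

Lemma mulx_le (g : X -> R) f : (forall x, `|g x| <= 1) ->
  rnorm (mulx g f) <= rnorm f.
Proof.
move=> /(mulx_mem f)[gf]; rewrite mul1r; apply: le_trans.
by rewrite lp_rnormE [X in lp_norm p X](mklpE gf).
Qed.

Lemma mulx_linear (g : X -> R) : (forall x, `|g x| <= 1) -> linear (mulx g).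
Proof.
move=> g1 l f h; apply: lp_eqP => x.
rewrite lp_addE lp_scaleE !mulxE// lp_addE lp_scaleE scalerDr !scalerA.
by rewrite mulrC.
Qed.

Definition delta (y : X) (x : X) : R := (x == y)%:R.

Lemma delta_le1 y x : `|delta y x| <= 1.
Proof. by rewrite /delta; case: eqP; rewrite ?normr0 ?normr1. Qed.

Lemma mulx_deltaE y f x : mulx (delta y) f x = if x == y then f y else 0.
Proof.
rewrite mulxE; last exact: delta_le1.
by rewrite /delta; case: eqP => [->|_]; rewrite ?scale1r ?scale0r.
Qed.

Lemma mulx_delta_le y f : rnorm (mulx (delta y) f) <= rnorm (f y).
Proof.
have := @lp_norm_point _ _ _ p (mulx (delta y) f) y hp.
rewrite lp_rnormE mulx_deltaE eqxx; apply; last exact: lp_memP.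
by move=> x /negbTE xy; rewrite mulx_deltaE xy.
Qed.

Definition cutoff (F : {fset X}) (f : L) : L :=
  mulx (fun x => (x \in F)%:R) f.

Lemma indicator_le1 (F : {fset X}) x : `|(x \in F)%:R : R| <= 1.
Proof. by case: (x \in F); rewrite ?normr1 ?normr0. Qed.

Lemma cutoffE F f x : cutoff F f x = if x \in F then f x else 0.
Proof.
rewrite /cutoff (mulxE _ _ (indicator_le1 F)).
by case: (x \in F); rewrite ?scale1r ?scale0r.
Qed.

Lemma cutoff_le F f : rnorm (cutoff F f) <= rnorm f.
Proof. exact/mulx_le/indicator_le1. Qed.

Lemma cutoff_sum F f : cutoff F f = \sum_(y <- F) mulx (delta y) f.
Proof.
apply: lp_eqP => x; rewrite cutoffE lp_sumE.
case: ifPn => xF.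
  rewrite (big_rem x)//= mulx_deltaE eqxx big_seq big1 ?addr0// => y.
  rewrite mem_rem_uniq ?fset_uniq// !inE => /andP[yx _].
  by rewrite mulx_deltaE eq_sym (negbTE yx).
rewrite big_seq big1// => y yF.
by rewrite mulx_deltaE; case: eqP => // xy; rewrite xy yF in xF.
Qed.

(** The row at [x] only sees the ball of radius [rho]: the matrix is supported
    in a band. *)
Definition local_within (rho : R) (a : bop L) := forall (f : L) x,
  (forall y, mdist x y <= rho -> f y = 0) -> a f x = 0.

Lemma indicCb_bounded (A : set X) :
  bounded_fun (fun x => (if x \in A then 1 else 0) : R[i]^o).
Proof.
apply/bounded_fun_rnorm; exists 1 => x.
by case: ifP => _; rewrite /rnorm ?normr1 ?normr0//= ler01.
Qed.

Definition indicCb (A : set X) : Cb X :=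
  MkCb (@discrete_continuous _ _ bgX _ _) (indicCb_bounded A).

Lemma supp_indicCb (A : set X) x : supp (indicCb A) x -> A x.
Proof.
rewrite discrete_suppE//=; case: ifPn => [/set_mem//|_]; by rewrite eqxx.
Qed.

(** Locality is finite propagation tested with the indicators of a point and
    of the complement of a ball, which are continuous because the space is
    discrete. The distance from [x] to the points farther than [r + 1] is at
    least [r + 1], hence larger than [r]. *)
Lemma finite_propagationP (a : bop L) :
  finite_propagation a <-> exists2 rho, 0 <= rho & local_within rho a.
Proof.
split=> [[r r0 ha]|[rho r0 la]].
  exists (r + 1) => [|f x fx]; first by rewrite addr_ge0.
  pose u := indicCb [set x]; pose w := indicCb [set y | r + 1 < mdist x y].
  have uw : (r%:E < set_dist (supp u) (supp w))%E.
    apply: (@lt_le_trans _ _ (r + 1)%:E); first by rewrite lte_fin ltrDl.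
    apply: le_ereal_inf_tmp => _ [y /supp_indicCb -> [z /supp_indicCb/= xz <-]].
    by rewrite lee_fin ltW.
  have wf : Cb_mul w f = f.
    apply: lp_eqP => y /=; case: ifPn => [_|/negP]; first by rewrite scale1r.
    rewrite inE/= => /negP; rewrite -leNgt => /fx ->.
    by rewrite scaler0.
  have := ha u w uw f; rewrite wf => /(congr1 (fun h : L => h x))/=.
  by rewrite mem_set// scale1r.
exists rho => // u w uw f; apply: lp_eqP => x; rewrite lp_zeroE /=.
have [->|ux] := eqVneq (u x) 0; first by rewrite scale0r.
rewrite la ?scaler0// => y xy /=.
have [->|wy] := eqVneq (w y) 0; first by rewrite scale0r.
move: uw; rewrite ltNge => /negP; case.
apply: (@le_trans _ _ (mdist x y)%:E); last by rewrite lee_fin.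
apply: ereal_inf_lbound; exists x; first by rewrite discrete_suppE.
by exists y => //; rewrite discrete_suppE.
Qed.

(** The value at [x] depends on the restriction of [f] to a finite ball, which
    is the sum of its values at points, each of norm at most [rnorm (f y)]. *)
Lemma local_le (rho : R) (a : bop L) (f : L) x : local_within rho a ->
  rnorm (a f x) <= op_norm a * \sum_(y <- fball x rho) rnorm (f y).
Proof.
move=> la; have -> : a f x = a (cutoff (fball x rho) f) x.
  apply/eqP; rewrite -subr_eq0 -lp_subE -linearB; apply/eqP.
  apply: la => y; rewrite -(in_fball bgX) => yx.
  by rewrite lp_subE cutoffE yx subrr.
rewrite cutoff_sum linear_sum lp_sumE mulr_sumr.
apply: le_trans (rnorm_sum _ _) _; apply: ler_sum => y _.
apply: le_trans (lp_eval_le _ _) _; apply: le_trans (op_norm_ub _ _) _.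
by rewrite ler_wpM2l ?op_norm_ge0// mulx_delta_le.
Qed.

(* commutator *)
Definition mulx_comm (g : X -> R) (a : bop L) (f : L) : L :=
  mulx g (a f) - a (mulx g f).

(** The value at [x] of the commutator is that of [a] at the function
    [(g x - g) f]. *)
Lemma mulx_comm_local_le (rho : R) (a : bop L) (g : X -> R) (f : L) x :
  (forall x, 0 <= g x <= 1) -> local_within rho a ->
  rnorm (mulx_comm g a f x) <=
  op_norm a * \sum_(y <- fball x rho) `|g x - g y| * rnorm (f y).
Proof.
move=> g01 la.
have g1 y : `|g y| <= 1 by have /andP[? ?] := g01 y; rewrite ger0_norm.
have -> : mulx_comm g a f x = a ((g x)%:C *: f - mulx g f) x.
  by rewrite /mulx_comm linearB linearZ lp_subE lp_subE lp_scaleE mulxE.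
apply: le_trans (local_le _ _ la) _.
rewrite ler_wpM2l ?op_norm_ge0//; apply: ler_sum => y _.
by rewrite lp_subE lp_scaleE mulxE// -scalerBl -rmorphB rnormZr.
Qed.

(** The only place where invertibility enters: it transfers commutator
    estimates from [a] to its inverse. *)
Lemma mulx_comm_inv (g : X -> R) (a b : bop L) (f : L) :
  cancel a b -> cancel b a -> mulx_comm g b f = - b (mulx_comm g a (b f)).
Proof. by move=> ab ba; rewrite /mulx_comm linearB/= ab ba opprB. Qed.

End lp_elements.

(** * Commutators with slowly varying functions *)

Section commutators.
Context {R : realType} {X : metricType R} {p : \bar R} {hp : lp_exponent p}.
Context {E : normedModType R[i]}.
Hypothesis bgX : bounded_geometry X.
Local Notation L := (lp hp X E).

Lemma mulx_comm_perturb (g : X -> R) (a a0 : bop L) (f : L) :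
  (forall x, `|g x| <= 1) ->
  mulx_comm g a f = mulx_comm g a0 f + (a0 - a) (mulx g f) - mulx g ((a0 - a) f).
Proof.
move=> g1; have mB (u v : L) : mulx g (u - v) = mulx g u - mulx g v.
  by rewrite -scaleN1r addrC (mulx_linear bgX g1) scaleN1r addrC.
have dE (v : L) : (a0 - a) v = a0 v - a v by [].
by rewrite /mulx_comm !dE mB subrKA opprB [RHS]addrC subrKA.
Qed.

Lemma unit_interval_norm (g : X -> R) :
  (forall x, 0 <= g x <= 1) -> forall x, `|g x| <= 1.
Proof. by move=> g01 x; have /andP[? ?] := g01 x; rewrite ger0_norm. Qed.

(** For a finite propagation operator [a0] close to [a], the commutator is
    bounded by the sum over a ball, which has a bounded number of terms; the
    difference [a0 - a] contributes twice its norm. *)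
Lemma mulx_comm_sup_le (a : bop L) : (forall f : X -> E, lp_norm p f = sup_norm f) ->
  band_dominated hp X E a ->
  forall e : R, 0 < e -> exists2 rho : R, 0 <= rho & exists2 eta : R, 0 < eta &
    forall g : X -> R, (forall x, 0 <= g x <= 1) ->
    (forall x y, mdist x y <= rho -> `|g x - g y| <= eta) ->
    forall f, rnorm (mulx_comm g a f) <= e * rnorm f.
Proof.
move=> supE /closure_bopP aFP e e0.
have e3 : 0 < e / 3 by rewrite divr_gt0.
have [a0 /(finite_propagationP bgX)[rho rho0 la0] a0a] := aFP _ e3.
have [N sN] := size_fball bgX rho0.
pose K := op_norm a0 * N%:R.
have K0 : 0 <= K by rewrite mulr_ge0 ?op_norm_ge0.
exists rho => //; exists (e / 3 / (K + 1)); first by rewrite divr_gt0// ltr_wpDl.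
move=> g g01 gv f; have g1 := unit_interval_norm g01.
have h1 : rnorm (mulx_comm g a0 f) <= e / 3 * rnorm f.
  rewrite [leLHS]lp_rnormE supE; apply: sup_norm_le => [|x].
    by rewrite mulr_ge0 ?rnorm_ge0// ltW.
  apply: le_trans (mulx_comm_local_le bgX f x g01 la0) _.
  apply: (@le_trans _ _ (op_norm a0 *
    \sum_(y <- fball x rho) (e / 3 / (K + 1) * rnorm f))).
    rewrite ler_wpM2l ?op_norm_ge0// big_seq [leRHS]big_seq; apply: ler_sum => y.
    rewrite in_fball// => xy.
    by rewrite ler_pM ?normr_ge0 ?rnorm_ge0 ?gv// lp_eval_le.
  rewrite big_const_seq count_predT iter_addr_0 -[_ *+ size _]mulr_natl.
  rewrite mulrA [leLHS]mulrA ler_wpM2r ?rnorm_ge0//.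
  rewrite mulrCA ler_piMr ?(ltW e3)// ler_pdivrMr ?ltr_wpDl// mul1r.
  by rewrite (@le_trans _ _ K) ?lerDl// ler_wpM2l ?op_norm_ge0// ler_nat.
rewrite (mulx_comm_perturb a a0 f g1).
have -> : e * rnorm f = e / 3 * rnorm f + e / 3 * rnorm f + e / 3 * rnorm f by field.
apply: le_trans (ler_rnormD _ _) _; rewrite rnormN; apply: lerD.
  apply: le_trans (ler_rnormD _ _) _; apply: lerD => //.
  apply: le_trans (a0a _) _; rewrite ler_wpM2l ?(ltW e3)//.
  exact: mulx_le.
by apply: le_trans (mulx_le bgX _ g1) _; exact: a0a.
Qed.

End commutators.

Section commutators_lr.
Context {R : realType} {X : metricType R} {r : R} {hp : lp_exponent r%:E}.
Context {E : normedModType R[i]}.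
Hypothesis bgX : bounded_geometry X.
Hypothesis r1 : 1 <= r.
Local Notation L := (lp hp X E).

Let r0 : 0 < r. Proof. exact: lt_le_trans r1. Qed.

Lemma lp_psumE (f : L) : psum r f = (rnorm f `^ r)%:E.
Proof.
have := lp_memP f; rewrite lp_rnormE /lp_mem /lp_norm gt_eqF// => fr.
by rewrite powR_invK ?fine_ge0 ?psum_ge0// fineK// ge0_fin_numE ?psum_ge0.
Qed.

Lemma lp_psum_mem (f : X -> E) : lp_mem r%:E f <-> (psum r f < +oo)%E.
Proof. by rewrite /lp_mem gt_eqF. Qed.

Lemma psum_op_le (f g : L) (d : R) : 0 <= d -> rnorm f <= d * rnorm g ->
  (psum r f <= (d `^ r)%:E * psum r g)%E.
Proof.
move=> d0 fg; rewrite !lp_psumE -EFinM lee_fin -powRM ?rnorm_ge0//.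
by rewrite ge0_ler_powR ?nnegrE ?mulr_ge0 ?rnorm_ge0// ltW.
Qed.

(** Exchange the sums: at each point the weights [phi_i x ^ r] add up to at
    most 1. *)
Lemma esum_mulx_le (I : choiceType) (phi : I -> X -> R) (f : L) :
  (forall i x, 0 <= phi i x <= 1) ->
  (forall x, \esum_(i in [set: I]) (phi i x `^ r)%:E <= 1)%E ->
  (\esum_(i in [set: I]) psum r (mulx (phi i) f) <= psum r f)%E.
Proof.
move=> phi01 phi1; rewrite /psum exchange_esum; last first.
  by move=> i x; rewrite lee_fin powR_ge0.
apply: le_esum => x _.
apply: (@le_trans _ _ (\esum_(i in [set: I])
    (rnorm (f x) `^ r * phi i x `^ r)%:E)%E).
  apply: le_esum => i _; have /andP[pi0 _] := phi01 i x.
  rewrite lee_fin mulxE//; last exact: unit_interval_norm.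
  by rewrite rnormZr ger0_norm// powRM ?rnorm_ge0// mulrC.
apply: le_trans (esumZ_le (powR_ge0 _ _) _) _.
  by move=> i; exact: powR_ge0.
by rewrite -[leRHS]mule1 lee_wpmul2l ?lee_fin ?powR_ge0.
Qed.

(** Pointwise, the [r]-th powers of the commutators are bounded by
    [|phi_i x - phi_i y| ^ r |f y| ^ r] summed over a ball. Summing
    over [i] first produces the variation of the family, which is at most
    [eta]; the sum over [x] is then a Schur test. *)
Lemma mulx_comm_local_esum_le (I : choiceType) (phi : I -> X -> R) (rho eta : R)
    (N : nat) (a : bop L) (f : L) :
  local_within rho a -> (forall x : X, (size (fball x rho) <= N)%N) ->
  0 <= eta -> (forall i x, 0 <= phi i x <= 1) ->
  (forall x y, mdist x y <= rho ->
    (\esum_(i in [set: I]) (`|phi i x - phi i y| `^ r)%:E <= eta%:E)%E) ->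
  (\esum_(i in [set: I]) psum r (mulx_comm (phi i) a f) <=
   ((op_norm a * N%:R) `^ r * eta * N%:R)%:E * psum r f)%E.
Proof.
move=> la sN eta0 phi01 phiv; rewrite /psum exchange_esum; last first.
  by move=> i x; rewrite lee_fin powR_ge0.
set C := (_ * _) `^ r; have C0 : 0 <= C by exact: powR_ge0.
apply: (@le_trans _ _ (\esum_(x in [set: X]) ((C * eta) *
   \sum_(y <- fball x rho) rnorm (f y) `^ r)%:E)%E); last first.
  have Ce : 0 <= C * eta by rewrite mulr_ge0.
  apply: le_trans (esumZ_le Ce _) _.
    by move=> x; apply: sumr_ge0 => y _; exact: powR_ge0.
  rewrite (EFinM (C * eta)) -muleA lee_wpmul2l ?lee_fin//.
  by apply: (schur_esum bgX) => // y; exact: powR_ge0.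
apply: le_esum => x _.
apply: (@le_trans _ _ (\esum_(i in [set: I]) (C *
   \sum_(y <- fball x rho) (rnorm (f y) `^ r * `|phi i x - phi i y| `^ r))%:E)%E).
  apply: le_esum => i _; rewrite lee_fin.
  apply: (@le_trans _ _ ((op_norm a *
    \sum_(y <- fball x rho) `|phi i x - phi i y| * rnorm (f y)) `^ r)).
    rewrite ge0_ler_powR ?nnegrE ?rnorm_ge0 ?(ltW r0) ?mulr_ge0 ?op_norm_ge0 ?sumr_ge0//.
      by move=> y _; rewrite mulr_ge0 ?rnorm_ge0.
    exact: mulx_comm_local_le.
  rewrite powRM ?op_norm_ge0 ?sumr_ge0//; last first.
    by move=> y _; rewrite mulr_ge0 ?rnorm_ge0.
  rewrite /C powRM ?op_norm_ge0// -[leRHS]mulrA ler_wpM2l ?powR_ge0//.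
  apply: le_trans (powR_sum_le _ r0 _) _ => [y|].
    by rewrite mulr_ge0 ?rnorm_ge0.
  under eq_bigr do rewrite powRM ?rnorm_ge0// mulrC.
  rewrite ler_wpM2r//.
    by apply: sumr_ge0 => y _; rewrite mulr_ge0 ?powR_ge0.
  by rewrite ge0_ler_powR ?nnegrE ?(ltW r0)// ler_nat.
apply: le_trans (esumZ_le C0 _) _.
  by move=> i; apply: sumr_ge0 => y _; rewrite mulr_ge0 ?powR_ge0.
rewrite -mulrA (EFinM C) lee_wpmul2l ?lee_fin//.
under eq_esum do rewrite -sumEFin.
rewrite esum_sum; last by move=> i y _ _; rewrite lee_fin mulr_ge0 ?powR_ge0.
rewrite mulr_sumr -sumEFin big_seq [leRHS]big_seq; apply: lee_sum => y.
rewrite (in_fball bgX) => xy; apply: le_trans (esumZ_le _ _) _.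
- exact: powR_ge0.
- by move=> i; exact: powR_ge0.
- by rewrite mulrC EFinM lee_wpmul2l ?lee_fin ?powR_ge0// phiv.
Qed.

Lemma psum3_le (u v w : L) :
  (psum r (u + v - w)%R <= (3 `^ r)%:E * (psum r u + psum r v + psum r w))%E.
Proof.
rewrite !lp_psumE -!EFinD -EFinM lee_fin.
apply: le_trans (powR_add3_le r0 _ _ _); rewrite ?rnorm_ge0//.
rewrite ge0_ler_powR ?nnegrE ?(ltW r0) ?rnorm_ge0//.
  by apply: addr_ge0; rewrite ?addr_ge0 ?rnorm_ge0.
apply: le_trans (ler_rnormD _ _) _; rewrite rnormN lerD2r.
exact: ler_rnormD.
Qed.

(** For a finite propagation operator [a0] close to [a], the commutators are
    controlled by the variation of the family. The difference [a0 - a] is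
    small on each piece [phi_i f], and [esum_mulx_le] adds the pieces up. *)
Lemma mulx_comm_esum_le (a : bop L) : band_dominated hp X E a ->
  forall e : R, 0 < e -> exists2 rho : R, 0 <= rho & exists2 eta : R, 0 < eta &
    forall (I : choiceType) (phi : I -> X -> R),
    (forall i x, 0 <= phi i x <= 1) ->
    (forall x, \esum_(i in [set: I]) (phi i x `^ r)%:E <= 1)%E ->
    (forall x y, mdist x y <= rho ->
      (\esum_(i in [set: I]) (`|phi i x - phi i y| `^ r)%:E <= eta%:E)%E) ->
    forall f, (\esum_(i in [set: I]) psum r (mulx_comm (phi i) a f) <=
      e%:E * psum r f)%E.
Proof.
move=> /closure_bopP aFP e e0.
have t0 : 0 < 3 `^ r :> R by rewrite powR_gt0.
have [c c0 cE] : exists2 c, 0 < c & e = 3 `^ r * (c + c + c).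
  exists (e / (3 `^ r * 3)); first by rewrite divr_gt0// mulr_gt0.
  by field; rewrite gt_eqF.
pose d := c `^ r^-1; have d0 : 0 < d by rewrite powR_gt0.
have dE : d `^ r = c by rewrite powR_invK// ltW.
have [a0 /(finite_propagationP bgX)[rho rho0 la0] a0a] := aFP _ d0.
have [N sN] := size_fball bgX rho0.
pose K := (op_norm a0 * N%:R) `^ r * N%:R.
have K0 : 0 <= K by rewrite mulr_ge0 ?powR_ge0.
exists rho => //; exists (c / (K + 1)); first by rewrite divr_gt0// ltr_wpDl.
move=> I phi phi01 phi1 phiv f.
have eta0 : 0 <= c / (K + 1) by rewrite divr_ge0 ?addr_ge0 ?(ltW c0).
have h0 g : (psum r ((a0 - a)%R g) <= c%:E * psum r g)%E.
  by rewrite -dE; apply: psum_op_le; [exact: ltW|exact: a0a].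
have P0 := psum_ge0 r f.
have c0' : (0 <= c%:E)%E by rewrite lee_fin ltW.
apply: (@le_trans _ _ (\esum_(i in [set: I]) ((3 `^ r)%:E *
   (psum r (mulx_comm (phi i) a0 f) + psum r ((a0 - a)%R (mulx (phi i) f)) +
    psum r (mulx (phi i) ((a0 - a)%R f)))))%E).
  apply: le_esum => i _.
  rewrite (mulx_comm_perturb bgX a a0)//; last exact: unit_interval_norm.
  exact: psum3_le.
under eq_esum do rewrite !lp_psumE -!EFinD -EFinM.
apply: le_trans (esum_add3_le _ _ _ _) _; try by move=> *; rewrite powR_ge0.
rewrite cE (EFinM (3 `^ r)) -muleA lee_wpmul2l ?lee_fin ?(ltW t0)//.
rewrite !EFinD !ge0_muleDl ?adde_ge0//; apply: leeD; first apply: leeD.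
- under eq_esum do rewrite -lp_psumE.
  apply: le_trans (mulx_comm_local_esum_le f la0 sN eta0 phi01 phiv) _.
  rewrite lee_wpmul2r// lee_fin mulrAC -/K mulrCA.
  by rewrite ler_piMr ?(ltW c0)// ler_pdivrMr ?ltr_wpDl// mul1r lerDl.
- apply: (@le_trans _ _ (\esum_(i in [set: I]) (c * rnorm (mulx (phi i) f) `^ r)%:E)%E).
    by apply: le_esum => i _; have := h0 (mulx (phi i) f); rewrite !lp_psumE -EFinM.
  apply: le_trans (esumZ_le (ltW c0) _) _; first by move=> i; exact: powR_ge0.
  rewrite lee_wpmul2l//; under eq_esum do rewrite -lp_psumE.
  exact: esum_mulx_le.
- under eq_esum do rewrite -lp_psumE.
  apply: le_trans (esum_mulx_le _ phi01 phi1) _; exact: h0.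
Qed.

End commutators_lr.

(** * Exponents 0 and infinity *)

Section tent.
Context {R : realType} {X : metricType R}.

Definition tent (l : R) (x y : X) : R := Num.max 0 (1 - mdist x y / l).

Lemma tent01 l x y : 0 < l -> 0 <= tent l x y <= 1.
Proof.
move=> l0; rewrite /tent le_max lexx/= ge_max ler01/=.
by rewrite lerBlDr lerDl divr_ge0 ?mdist_ge0 ?ltW.
Qed.

Lemma tentxx l x : tent l x x = 1.
Proof. by rewrite /tent mdistxx mul0r subr0; apply/max_idPr. Qed.

Lemma tent_out l x y : 0 < l -> l <= mdist x y -> tent l x y = 0.
Proof.
move=> l0 lxy; apply/max_idPl.
by rewrite subr_le0 ler_pdivlMr// mul1r.
Qed.

Lemma tent_dist l x y z : 0 < l -> `|tent l x y - tent l x z| <= mdist y z / l.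
Proof.
move=> l0.
have h u v : tent l x u - tent l x v <= mdist u v / l.
  rewrite lerBlDr /tent ge_max; apply/andP; split.
    by rewrite addr_ge0 ?le_max ?lexx// divr_ge0 ?mdist_ge0 ?ltW.
  have tri : mdist x v / l <= mdist x u / l + mdist u v / l.
    by rewrite -mulrDl ler_wpM2r ?invr_ge0 ?(ltW l0)// metric_triangle.
  have : 1 - mdist x v / l <= Num.max 0 (1 - mdist x v / l).
    by rewrite le_max lexx orbT.
  by move: (Num.max 0 _) tri => m; lra.
by rewrite ler_norml h andbT lerNl opprB metric_sym h.
Qed.

End tent.

Section sup_case.
Context {R : realType} {X : metricType R} {p : \bar R} {hp : lp_exponent p}.
Context {E : normedModType R[i]}.
Hypothesis bgX : bounded_geometry X.
Local Notation L := (lp hp X E).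

Lemma tent_norm l (x y : X) : 0 < l -> `|tent l x y : R| <= 1.
Proof. by move=> l0; apply: unit_interval_norm => z; exact: tent01. Qed.

Lemma tent_mulx_le (T : bop L) (f : L) l (x : X) : 0 < l ->
  rnorm (T (mulx (tent l x) f) x) <= op_norm T * rnorm (mulx (tent l x) f).
Proof. by move=> l0; apply: le_trans (lp_eval_le _ _) _; exact: op_norm_ub. Qed.

(** The approximation of [b] has at [x] the row of [b f_x], with [f_x] the
    tent at [x]. Membership of the result in the space depends on the exponent
    and is left as a hypothesis. *)
Lemma sup_inverse_closed :
  (forall f : X -> E, lp_norm p f = sup_norm f) ->
  (forall (T : bop L) (f : L) l, 0 < l ->
    lp_mem p (fun x => T (mulx (tent l x) f) x)) ->
  closed_under_inverses (band_dominated hp X E).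
Proof.
move=> supE memT a b abd ab ba; apply/closure_bopP => e e0.
pose K := op_norm b * op_norm b.
have K0 : 0 <= K by rewrite mulr_ge0 ?op_norm_ge0.
have e'0 : 0 < e / (K + 1) by rewrite divr_gt0// ltr_wpDl.
have [rho rho0 [eta eta0 ha]] := mulx_comm_sup_le bgX supE abd e'0.
(* With slope [1 / l], points at distance [rho] have values [eta]-close; the
   added 1 keeps [l] positive when [rho] is 0. *)
pose l := rho / eta + 1; have l0 : 0 < l by rewrite ltr_wpDl// divr_ge0 ?(ltW eta0).
have b1 x y := tent_norm x y l0.
pose F (f : L) : L := mklp (fun x => b (mulx (tent l x) f) x).
have FE f x : F f x = b (mulx (tent l x) f) x by rewrite (mklpE (memT b f l l0)).
have Flin : linear F.
  move=> k f g; apply: lp_eqP => x; rewrite lp_addE lp_scaleE !FE.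
  by rewrite (mulx_linear bgX (b1 x)) linearP.
have Fbd f : rnorm (F f) <= op_norm b * rnorm f.
  rewrite [leLHS]lp_rnormE supE; apply: sup_norm_le => [|x].
    by rewrite mulr_ge0 ?op_norm_ge0 ?rnorm_ge0.
  rewrite FE; apply: le_trans (tent_mulx_le _ _ _ l0) _.
  by rewrite ler_wpM2l ?op_norm_ge0//; exact: mulx_le.
exists (Bop (bop_pred_of Flin Fbd)).
  apply/(finite_propagationP bgX); exists l; first exact: ltW.
  move=> f x fx; rewrite /= FE (_ : mulx _ f = 0) ?linear0//.
  apply: lp_eqP => y; rewrite mulxE// lp_zeroE.
  have [xy|/ltW xy] := leP (mdist x y) l; first by rewrite fx ?scaler0.
  by rewrite tent_out ?scale0r.
move=> f; rewrite [leLHS]lp_rnormE supE; apply: sup_norm_le => [|x].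
  by rewrite mulr_ge0 ?rnorm_ge0// ltW.
have -> : (Bop (bop_pred_of Flin Fbd) f - b f) x = - mulx_comm (tent l x) b f x.
  by rewrite /mulx_comm !lp_subE /= FE mulxE// tentxx scale1r opprB.
rewrite rnormN; apply: le_trans (lp_eval_le _ _) _.
rewrite (mulx_comm_inv _ _ ab ba) rnormN; apply: le_trans (op_norm_ub _ _) _.
have h : rnorm (mulx_comm (tent l x) a (b f)) <= e / (K + 1) * (op_norm b * rnorm f).
  apply: le_trans (ha _ _ _ _) _.
  - by move=> y; exact: tent01.
  - move=> y z yz; apply: le_trans (tent_dist _ _ _ l0) _.
    rewrite ler_pdivrMr// (le_trans yz)// /l mulrDr mulr1 mulrC divfK ?gt_eqF//.
    by rewrite lerDl ltW.
  - by rewrite ler_wpM2l ?(ltW e'0)// op_norm_ub.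
apply: le_trans (ler_wpM2l (op_norm_ge0 _) h) _.
have -> : op_norm b * (e / (K + 1) * (op_norm b * rnorm f)) =
    e * (K / (K + 1)) * rnorm f by rewrite /K; ring.
rewrite ler_wpM2r ?rnorm_ge0//.
by rewrite ler_piMr ?(ltW e0)// ler_pdivrMr ?ltr_wpDl// mul1r lerDl.
Qed.

End sup_case.

Section sup_exponents.
Context {R : realType} {X : metricType R} {E : normedModType R[i]}.
Hypothesis bgX : bounded_geometry X.

Lemma linfty_inverse_closed (hp : lp_exponent (+oo%E : \bar R)) :
  closed_under_inverses (band_dominated hp X E).
Proof.
apply: sup_inverse_closed => // T f l l0; apply/bounded_fun_rnorm.
exists (op_norm T * rnorm f) => x; apply: le_trans (tent_mulx_le _ _ _ l0) _.
rewrite ler_wpM2l ?op_norm_ge0//; apply: mulx_le => // y.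
exact: tent_norm.
Qed.

(** If [f] is small outside a finite set [K], then the product of [f] with the
    tent at [x] is small everywhere as soon as [x] is outside the
    [l]-neighbourhood of [K], which is finite too. *)
Lemma c0_inverse_closed (hp : lp_exponent (0%E : \bar R)) :
  closed_under_inverses (band_dominated hp X E).
Proof.
have supE (f : X -> E) : lp_norm 0%E f = sup_norm f by rewrite /lp_norm/= eqxx.
apply: sup_inverse_closed => // T f l l0.
rewrite /lp_mem/= eqxx; split; first exact: discrete_continuous.
move=> e e0; pose d := e / (op_norm T + 1).
have T1 : 0 < op_norm T + 1 by rewrite ltr_wpDl ?op_norm_ge0.
have d0 : 0 < d by rewrite divr_gt0.
have := lp_memP f; rewrite /lp_mem/= eqxx => -[_ /(_ _ d0)[K cK Kf]].
exists (\bigcup_(y in K) [set x | mdist y x <= l]).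
  apply: finite_compact; apply: bigcup_finite; first exact: discrete_compact cK.
  by move=> y _; exact: finite_ball.
move=> x xK; apply: le_lt_trans (tent_mulx_le _ _ _ l0) _.
apply: (@le_lt_trans _ _ (op_norm T * d)).
  rewrite ler_wpM2l ?op_norm_ge0// lp_rnormE supE.
  apply: sup_norm_le => [|y]; first exact: ltW.
  rewrite mulxE//; last by move=> z; exact: tent_norm.
  have [Ky|/Kf/ltW fy] := pselect (K y).
    rewrite tent_out// ?scale0r ?rnorm0 ?(ltW d0)//.
    rewrite leNgt; apply/negP => xy; apply: xK; exists y => //=.
    by rewrite metric_sym ltW.
  rewrite rnormZr; apply: le_trans fy; rewrite ler_piMl ?rnorm_ge0//.
  exact: tent_norm.
rewrite /d mulrCA gtr_pMr// ltr_pdivrMr// mul1r ltrDl ltr01//.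
Qed.

End sup_exponents.

(** * Block operators for finite exponents *)

Section finite_exponent.
Context {R : realType} {X : metricType R} {r : R} {hp : lp_exponent r%:E}.
Context {E : normedModType R[i]}.
Hypothesis bgX : bounded_geometry X.
Hypothesis r1 : 1 <= r.
Local Notation L := (lp hp X E).

Let r0 : 0 < r. Proof. exact: lt_le_trans r1. Qed.

(** The form in which Holder's inequality is used: a pointwise bound by an
    [r]-sum gives a bound of norms, since the two sums commute. *)
Lemma psum_le_esum (I : choiceType) (f : X -> E) (u : I -> L) :
  (forall x, ((rnorm (f x) `^ r)%:E <=
    \esum_(i in [set: I]) (rnorm (u i x) `^ r)%:E)%E) ->
  (psum r f <= \esum_(i in [set: I]) psum r (u i))%E.
Proof.
move=> fu; rewrite /psum exchange_esum; first by apply: le_esum => x _; exact: fu.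
by move=> i x; rewrite lee_fin powR_ge0.
Qed.

Lemma esum_psum_op_le (I : choiceType) (T : bop L) (u : I -> L) :
  (\esum_(i in [set: I]) psum r (T (u i)) <=
   (op_norm T `^ r)%:E * \esum_(i in [set: I]) psum r (u i))%E.
Proof.
apply: (@le_trans _ _ (\esum_(i in [set: I])
    (op_norm T `^ r * rnorm (u i) `^ r)%:E)%E).
  apply: le_esum => i _.
  have := psum_op_le r1 (op_norm_ge0 T) (op_norm_ub T (u i)).
  by rewrite !lp_psumE -?EFinM.
apply: le_trans (esumZ_le (powR_ge0 _ _) _) _; first by move=> i; exact: powR_ge0.
rewrite lee_wpmul2l ?lee_fin ?powR_ge0//.
by apply: le_esum => i _; rewrite lp_psumE.
Qed.

Lemma psum_le_rnorm (f g : L) (d : R) : 0 <= d ->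
  (psum r f <= (d `^ r)%:E * psum r g)%E -> rnorm f <= d * rnorm g.
Proof.
move=> d0; rewrite !lp_psumE// -EFinM lee_fin -powRM ?rnorm_ge0// => fg.
rewrite -[leLHS](powR_powK r0 (rnorm_ge0 _)).
rewrite -[leRHS](powR_powK r0 (mulr_ge0 d0 (rnorm_ge0 _))).
by rewrite ge0_ler_powR ?nnegrE ?powR_ge0// invr_ge0 ltW.
Qed.

Lemma mulx_comm_inv_esum_le (I : choiceType) (phi : I -> X -> R) (a b : bop L)
    (u : I -> L) (d : \bar R) :
  cancel a b -> cancel b a ->
  (\esum_(i in [set: I]) psum r (mulx_comm (phi i) a (b (u i))) <= d)%E ->
  (\esum_(i in [set: I]) psum r (mulx_comm (phi i) b (u i)) <=
   (op_norm b `^ r)%:E * d)%E.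
Proof.
move=> ab ba h.
apply: (@le_trans _ _ (\esum_(i in [set: I]) psum r (b (mulx_comm (phi i) a (b (u i)))))%E).
  apply: le_esum => i _; rewrite (lp_psumE r1) (lp_psumE r1).
  rewrite (mulx_comm_inv _ _ ab ba).
  by rewrite [rnorm (- _)]rnormN.
apply: le_trans (esum_psum_op_le _ _) _.
by rewrite lee_wpmul2l ?lee_fin ?powR_ge0.
Qed.

Section blocks.
Context {I : choiceType} (S : X -> {fset I}) (psi phi : I -> X -> R) (D : R).
Hypothesis psi0 : forall i x, 0 <= psi i x.
Hypothesis phi01 : forall i x, 0 <= phi i x <= 1.
Hypothesis phi1 : forall x,
  (\esum_(i in [set: I]) (phi i x `^ r)%:E <= 1)%E.
Hypothesis psi_holder : forall x (t : I -> R), (forall i, 0 <= t i) ->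
  (\sum_(i <- S x) psi i x * t i) `^ r <= \sum_(i <- S x) t i `^ r.
Hypothesis D0 : 0 <= D.
Hypothesis phiD : forall i x y, i \in S x -> phi i y != 0 -> mdist x y <= D.

Lemma block_powR_le x (u : I -> E) :
  ((rnorm (\sum_(i <- S x) (psi i x)%:C *: u i) `^ r)%:E <=
    \esum_(i in [set: I]) (rnorm (u i) `^ r)%:E)%E.
Proof.
apply: le_trans (sum_fset_le_esum (S x) _); last by move=> i; exact: powR_ge0.
rewrite lee_fin; apply: le_trans (psi_holder _ _); last by move=> i; exact: rnorm_ge0.
rewrite ge0_ler_powR ?nnegrE ?(ltW r0) ?rnorm_ge0//.
  by apply: sumr_ge0 => i _; rewrite mulr_ge0 ?rnorm_ge0.
apply: le_trans (rnorm_sum _ _) _; apply: ler_sum => i _.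
by rewrite rnormZr ger0_norm.
Qed.

(** The operator [sum_i psi_i b phi_i], a finite sum at each point, is
    bounded by the norm of [b] as soon as the weights [psi] satisfy a Holder
    inequality, and has finite propagation when the pieces [phi_i] with [i] in
    [S x] live near [x]. Both the blocks given by Property A and the
    truncated columns used for exponent 1 are of this form. *)
Lemma block_operator (b : bop L) :
  exists2 c : bop L, finite_propagation c & forall f x,
    c f x = \sum_(i <- S x) (psi i x)%:C *: b (mulx (phi i) f) x.
Proof.
have p1 i := unit_interval_norm (phi01 i).
pose F0 (f : L) x := \sum_(i <- S x) (psi i x)%:C *: b (mulx (phi i) f) x.
have bd f : (psum r (F0 f) <= (op_norm b `^ r)%:E * psum r f)%E.
  apply: le_trans (psum_le_esum (u := fun i => b (mulx (phi i) f)) _) _.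
    by move=> x; exact: block_powR_le.
  apply: le_trans (esum_psum_op_le _ _) _.
  by rewrite lee_wpmul2l ?lee_fin ?powR_ge0//; exact: esum_mulx_le.
have F0E f : (mklp (F0 f) : L) = F0 f :> (X -> E).
  apply: mklpE. apply: (lp_psum_mem r1 _).2; apply: le_lt_trans (bd f) _.
  by rewrite lp_psumE// -EFinM ltry.
have [F FE] : exists F : L -> L, forall f x, F f x = F0 f x.
  by exists (fun f => mklp (F0 f)) => f x; rewrite F0E.
have Flin : linear F.
  move=> k f g; apply: lp_eqP => x.
  rewrite lp_addE lp_scaleE.
  rewrite 3!FE.
  rewrite /F0 scaler_sumr -big_split.
  apply: eq_bigr => i _ /=.
  rewrite (mulx_linear bgX (p1 i)).
  rewrite linearP.
  rewrite lp_addE lp_scaleE.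
  rewrite scalerDr.
  by rewrite scalerA scalerA mulrC.
have Fbd f : rnorm (F f) <= op_norm b * rnorm f.
  apply: psum_le_rnorm; first exact: op_norm_ge0.
  by rewrite (_ : lp_fun (F f) = F0 f)//; apply/funext => x; exact: FE.
exists (Bop (bop_pred_of Flin Fbd)); last by move=> f x; exact: FE.
apply/(finite_propagationP bgX); exists D => // f x fx.
rewrite /= FE /F0 big_seq big1// => i iS.
rewrite (_ : mulx _ f = 0) ?linear0 ?lp_zeroE ?scaler0//.
apply: lp_eqP => y; rewrite mulxE// lp_zeroE.
have [->|/(phiD iS)/fx ->] := eqVneq (phi i y) 0; first by rewrite scale0r.
by rewrite scaler0.
Qed.

End blocks.

End finite_exponent.

(** * Property A and exponents strictly between 1 and infinity *)

Section partitions.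
Context {R : realType} {X : metricType R}.
Hypothesis bgX : bounded_geometry X.

(** Property A may hold with an exponent [q] different from [r]; the powers
    [phi_i ^ (q / r)] are then a partition of unity for [r]. Their
    variation is at most [sum_i | phi_i x ^ q - phi_i y ^ q |],
    which [powR_dist] splits into a small multiple of
    [sum_i phi_i ^ q = 1] at both points and a multiple of the
    [q]-variation. *)
Lemma property_A_partition (r : R) : 1 <= r -> property_A X ->
  forall rho eta : R, 0 <= rho -> 0 < eta ->
  exists (I : choiceType) (phi : I -> X -> R) (D : R),
   [/\ forall i x, 0 <= phi i x <= 1,
       forall i x y, phi i x != 0 -> phi i y != 0 -> mdist x y <= D,
       forall x, finite_set [set i | phi i x != 0],
       forall x, (\esum_(i in [set: I]) (phi i x `^ r)%:E = 1)%E &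
       forall x y, mdist x y <= rho ->
         (\esum_(i in [set: I]) (`|phi i x - phi i y| `^ r)%:E <= eta%:E)%E].
Proof.
move=> r1 [q q1 hA] rho eta rho0 eta0.
have r0 : 0 < r by exact: lt_le_trans r1.
have q0 : 0 < q by exact: lt_le_trans q1.
have eta4 : 0 < eta / 4 by rewrite divr_gt0.
have [C C0 hC] := powR_dist q1 eta4.
have e0 : 0 < (eta / 2 / (C + 1)) by rewrite !divr_gt0// ltr_wpDl.
pose e := (eta / 2 / (C + 1)) `^ q^-1.
have eE : e `^ q = eta / 2 / (C + 1) by rewrite powR_invK// ltW.
(* Variation is only available at positive radii, and [rho] may be 0. *)
have [|I [phi [[phi01 [D hD] [M hM] phi1] phiv]]] :=
  hA (rho + 1) e _ (powR_gt0 _ e0); first by rewrite ltr_wpDl.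
have phi0 i x : 0 <= phi i x by have /andP[] := phi01 i x.
pose psi i x := phi i x `^ (q / r).
have psiE i x : psi i x = (phi i x `^ q) `^ r^-1 by rewrite /psi powRrM.
have psir i x : psi i x `^ r = phi i x `^ q by rewrite psiE powR_invK ?powR_ge0.
have psin0 i x : psi i x != 0 -> phi i x != 0.
  by apply: contra_neq => ph0; rewrite /psi ph0 powR0// mulf_neq0 ?invr_eq0 ?gt_eqF.
exists I, psi, D; split.
- move=> i x; rewrite powR_ge0/=; have /andP[p0 p1] := phi01 i x.
  have qr : 0 <= q / r by rewrite divr_ge0// ltW.
  have := ge0_ler_powR qr _ _ p1; rewrite powR1 !nnegrE; exact.
- by move=> i x y /psin0 ix /psin0 iy; apply: (hD i); rewrite discrete_suppE.
- move=> x; apply: (@sub_finite_set _ _ [set i | supp (phi i) x]).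
    by move=> i /= /psin0; rewrite discrete_suppE.
  by apply/finite_set_leP; exists M.
- by move=> x; under eq_esum do rewrite psir; exact: phi1.
- move=> x y xy.
  have xy1 : mdist x y <= rho + 1 by rewrite (le_trans xy)// lerDl.
  have := phiv x y xy1; rewrite eE => /ltW hv.
  apply: (@le_trans _ _ (\esum_(i in [set: I]) (1 *
    (eta / 4 * phi i x `^ q + eta / 4 * phi i y `^ q +
     C * `|phi i x - phi i y| `^ q))%:E)%E).
    apply: le_esum => i _; rewrite lee_fin mul1r -mulrDr !psiE.
    apply: le_trans (hC _ _ _ _) => //.
    by rewrite powR_inv_dist ?powR_ge0.
  apply: le_trans (esum_add3_le _ _ _ _) _ => //.
  + by move=> i; rewrite mulr_ge0 ?powR_ge0 ?ltW.
  + by move=> i; rewrite mulr_ge0 ?powR_ge0 ?ltW.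
  + by move=> i; rewrite mulr_ge0 ?powR_ge0.
  have -> : (eta%:E = (eta / 4)%:E + (eta / 4)%:E + (eta / 2)%:E)%E.
    by congr EFin; field.
  rewrite mul1e; apply: leeD; first apply: leeD.
  + apply: le_trans (esumZ_le (ltW eta4) _) _; first by move=> i; exact: powR_ge0.
    by rewrite phi1 mule1.
  + apply: le_trans (esumZ_le (ltW eta4) _) _; first by move=> i; exact: powR_ge0.
    by rewrite phi1 mule1.
  + apply: le_trans (esumZ_le C0 _) _; first by move=> i; exact: powR_ge0.
    apply: le_trans (lee_wpmul2l _ hv) _; first by rewrite lee_fin.
    rewrite -EFinM lee_fin mulrCA ler_piMr ?divr_ge0 ?(ltW eta0)//.
    by rewrite ler_pdivrMr ?ltr_wpDl// mul1r lerDl.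
Qed.

End partitions.

Section finite_exponent_closed.
Context {R : realType} {X : metricType R} {r : R} {hp : lp_exponent r%:E}.
Context {E : normedModType R[i]}.
Hypothesis bgX : bounded_geometry X.
Hypothesis r1 : 1 <= r.
Local Notation L := (lp hp X E).

Let r0 : 0 < r. Proof. exact: lt_le_trans r1. Qed.

(** Since [sum_i phi_i ^ r = 1], the difference between the block
    operator and [b] is the sum of the commutators of [b] with [phi_i],
    weighted by [phi_i ^ (r - 1)]. *)
Lemma lr_inverse_closed : property_A X ->
  closed_under_inverses (band_dominated hp X E).
Proof.
move=> hA a b abd ab ba; apply/closure_bopP => e e0.
pose K := op_norm b `^ r * op_norm b `^ r.
have K0 : 0 <= K by rewrite mulr_ge0 ?powR_ge0.
have d0 : 0 < e `^ r / (K + 1) by rewrite divr_gt0 ?powR_gt0// ltr_wpDl.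
have [rho rho0 [eta eta0 ha]] := mulx_comm_esum_le bgX r1 abd d0.
have [I [phi [D [phi01 phiD phif phi1 phiv]]]] :=
  property_A_partition bgX r1 hA rho0 eta0.
have p1 i := unit_interval_norm (phi01 i).
have phi0 i x : 0 <= phi i x by have /andP[] := phi01 i x.
pose S x := fset_set [set i | phi i x != 0].
have inS i x : (i \in S x) = (phi i x != 0).
  by rewrite /S in_fset_set//; apply/idP/idP; rewrite inE.
have sumS x : \sum_(i <- S x) phi i x `^ r = 1.
  apply: EFin_inj; rewrite -(phi1 x); symmetry; apply: esum_finsupp.
    by move=> i; exact: powR_ge0.
  by move=> i; rewrite inS negbK => /eqP ->; rewrite powR0 ?gt_eqF.
pose psi i x := phi i x `^ (r - 1).
have psi0 i x : 0 <= psi i x by exact: powR_ge0.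
have psi_holder x (t : I -> R) : (forall i, 0 <= t i) ->
    (\sum_(i <- S x) psi i x * t i) `^ r <= \sum_(i <- S x) t i `^ r.
  by move=> t0; apply: holder_sum_powR => //; rewrite sumS.
have phi_le1 x : (\esum_(i in [set: I]) (phi i x `^ r)%:E <= 1)%E by rewrite phi1.
have phiSD i x y : i \in S x -> phi i y != 0 -> mdist x y <= `|D|.
  by rewrite inS => ix iy; exact: le_trans (phiD _ _ _ ix iy) (ler_norm _).
have [c cfp cE] := block_operator bgX r1 psi0 phi01 phi_le1 psi_holder
  (normr_ge0 D) phiSD b.
exists c => // f; apply: (psum_le_rnorm r1 (ltW e0)).
pose u i := mulx_comm (phi i) b f.
have key x : (c f - b f) x = - \sum_(i <- S x) (psi i x)%:C *: u i x.
  rewrite lp_subE cE.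
  have -> : b f x = \sum_(i <- S x) (psi i x)%:C *: ((phi i x)%:C *: b f x).
    under eq_bigr do rewrite scalerA -rmorphM [psi _ _ * _]mulrC mulr_powRB1//.
    by rewrite -scaler_suml -rmorph_sum sumS scale1r.
  rewrite -sumrB -sumrN; apply: eq_bigr => i _.
  rewrite -scalerBr -[RHS]scalerN; congr (_ *: _).
  by rewrite /u /mulx_comm [in RHS]lp_subE mulxE// opprB.
apply: (@le_trans _ _ (\esum_(i in [set: I]) psum r (u i))%E).
  apply: psum_le_esum => x.
  rewrite key rnormN; exact: (block_powR_le r1 psi0 psi_holder).
have h := ha I phi phi01 phi_le1 phiv (b f).
apply: le_trans (mulx_comm_inv_esum_le r1 (u := fun=> f) ab ba h) _.
have := psum_op_le r1 (op_norm_ge0 b) (op_norm_ub b f).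
rewrite !(lp_psumE r1) -!EFinM !lee_fin => hb.
rewrite mulrA.
apply: (@le_trans _ _ (op_norm b `^ r * (e `^ r / (K + 1)) * (op_norm b `^ r * rnorm f `^ r))).
  by rewrite ler_wpM2l// mulr_ge0 ?powR_ge0 ?(ltW d0).
have -> : op_norm b `^ r * (e `^ r / (K + 1)) * (op_norm b `^ r * rnorm f `^ r) =
  e `^ r * (K / (K + 1)) * rnorm f `^ r by rewrite /K; ring.
rewrite ler_wpM2r ?powR_ge0// ler_piMr ?powR_ge0//.
by rewrite ler_pdivrMr ?ltr_wpDl// mul1r lerDl.
Qed.

End finite_exponent_closed.

(** * Exponent 1 *)

Section finite_support.
Context {R : realType} {X : metricType R} {r : R} {hp : lp_exponent r%:E}.
Context {E : normedModType R[i]}.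
Hypothesis bgX : bounded_geometry X.
Hypothesis r1 : 1 <= r.
Local Notation L := (lp hp X E).

Let r0 : 0 < r. Proof. exact: lt_le_trans r1. Qed.

Lemma cutoff_approx (f : L) (d : R) : 0 < d ->
  exists F : {fset X}, rnorm (f - cutoff F f) <= d.
Proof.
move=> d0; have dr0 : 0 < d `^ r by rewrite powR_gt0.
pose g x := rnorm (f x) `^ r; have g0 x : 0 <= g x by exact: powR_ge0.
have ffin : psum r f \is a fin_num by rewrite lp_psumE.
have [_ [A [finA _] <-]] := ub_ereal_sup_adherent dr0 ffin.
rewrite -/(psum r f) fsbig_finite// => hA.
pose F := fset_set A; exists F.
have psumF : psum r (cutoff F f) = (\sum_(y <- F) g y)%:E.
  rewrite -esum_mkfset// /psum; apply: eq_esum => y _; rewrite (cutoffE bgX) /g.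
  by case: ifP => _//; rewrite rnorm0 powR0 ?gt_eqF.
have psumD : (psum r f = psum r (f - cutoff F f)%R + psum r (cutoff F f))%E.
  rewrite /psum -esumD => [|x _|x _]; try by rewrite lee_fin powR_ge0.
  apply: eq_esum => x _; rewrite lp_subE (cutoffE bgX) -EFinD; congr EFin.
  case: ifP => _; first by rewrite subrr rnorm0 powR0 ?gt_eqF// add0r.
  by rewrite subr0 rnorm0 powR0 ?gt_eqF// addr0.
have {}hA : (psum r f - (d `^ r)%:E < psum r (cutoff F f))%E.
  by rewrite psumF -sumEFin; exact: hA.
have lt_d : rnorm (f - cutoff F f) `^ r <= d `^ r.
  have aux (t u v w : R) : (t%:E - w%:E < v%:E -> t%:E = u%:E + v%:E -> (u <= w)%R)%E.
    by rewrite -EFinB lte_fin => + []; lra.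
  by move: hA psumD; rewrite !lp_psumE//; exact: aux.
rewrite -(powR_powK r0 (rnorm_ge0 _)) -[leRHS](powR_powK r0 (ltW d0)).
by rewrite ge0_ler_powR ?nnegrE ?powR_ge0 ?invr_ge0 ?(ltW r0).
Qed.

(** An operator may thus be estimated on finitely supported functions, on
    which it is a finite sum of columns. *)
Lemma cutoff_dense (T : bop L) (e : R) : 0 <= e ->
  (forall (F : {fset X}) (f : L), (forall x, x \notin F -> f x = 0) ->
    rnorm (T f) <= e * rnorm f) ->
  forall f, rnorm (T f) <= e * rnorm f.
Proof.
move=> e0 hT f; apply/ler_addgt0Pl => d d0.
have K0 : 0 < op_norm T + 1 by rewrite ltr_wpDl ?op_norm_ge0.
have [F fF] := cutoff_approx f (divr_gt0 d0 K0).
rewrite -[f in leLHS](subrK (cutoff F f)) linearD.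
apply: le_trans (ler_rnormD _ _) _; apply: lerD.
  apply: le_trans (op_norm_ub _ _) _.
  apply: le_trans (ler_wpM2l (op_norm_ge0 _) fF) _.
  by rewrite mulrCA ler_piMr ?(ltW d0)// ler_pdivrMr// mul1r lerDl.
have h : rnorm (T (cutoff F f)) <= e * rnorm (cutoff F f).
  by apply: (hT F) => x xF; rewrite (cutoffE bgX) (negbTE xF).
exact: le_trans h (ler_wpM2l e0 (cutoff_le bgX F f)).
Qed.

End finite_support.

Section l1.
Context {R : realType} {X : metricType R} {hp : lp_exponent (1%:E : \bar R)}.
Context {E : normedModType R[i]}.
Hypothesis bgX : bounded_geometry X.
Local Notation L := (lp hp X E).

Let r1 : (1 : R) <= 1. Proof. exact: lexx. Qed.

Lemma delta01 (y x : X) : 0 <= (delta y x : R) <= 1.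
Proof. by rewrite /delta; case: eqP => _; rewrite ?lexx ler01. Qed.

Lemma esum_delta (x : X) :
  (\esum_(y in [set: X]) ((delta y x : R) `^ 1)%:E <= 1)%E.
Proof.
rewrite (@esum_finsupp _ _ [fset x]%fset); last 2 first.
- by move=> y; exact: powR_ge0.
- by move=> y; rewrite inE /delta eq_sym => /negbTE ->; rewrite powR0 ?oner_neq0.
by rewrite big_seq_fset1 /delta eqxx powR1.
Qed.

(** The column of [b] at [y] is multiplied by the tent [f_y] at [y]. As [f_y]
    is 1 at [y], on a function supported at [y] this differs from [b] by a
    commutator, and the 1-norm adds up the errors of the columns. *)
Lemma l1_inverse_closed : closed_under_inverses (band_dominated hp X E).
Proof.
move=> a b abd ab ba; apply/closure_bopP => e e0.
pose K := op_norm b * op_norm b.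
have K0 : 0 <= K by rewrite mulr_ge0 ?op_norm_ge0.
have d0 : 0 < e / (K + 1) by rewrite divr_gt0// ltr_wpDl.
have [rho rho0 [eta eta0 ha]] := mulx_comm_esum_le bgX r1 abd d0.
pose l := rho / eta + 1.
have l0 : 0 < l by rewrite ltr_wpDl// divr_ge0 ?(ltW eta0).
have bu01 (y x : X) : 0 <= tent l y x <= 1 by exact: tent01.
have bu0 (y x : X) : 0 <= tent l y x by have /andP[] := bu01 y x.
have bu1 y := unit_interval_norm (bu01 y).
have holder x (t : X -> R) : (forall i, 0 <= t i) ->
    (\sum_(i <- fball x l) tent l i x * t i) `^ 1 <=
    \sum_(i <- fball x l) t i `^ 1.
  move=> t0; rewrite powRr1; last by apply: sumr_ge0 => i _; rewrite mulr_ge0.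
  apply: ler_sum => i _; rewrite powRr1// ler_piMl//.
  by have /andP[] := bu01 i x.
have loc (i x y : X) : i \in fball x l -> (delta i y : R) != 0 -> mdist x y <= l.
  rewrite (in_fball bgX) /delta => xi; case: (eqVneq y i) => [->//|_].
  by rewrite eqxx.
have [c cfp cE] := block_operator bgX r1 bu0 delta01 esum_delta holder
  (ltW l0) loc b.
have ha1 (y : X) f : rnorm (mulx_comm (tent l y) a f) <= e / (K + 1) * rnorm f.
  apply: (psum_le_rnorm r1 (ltW d0)); rewrite (powRr1 (ltW d0)).
  apply: le_trans (ha unit (fun=> tent l y) (fun=> bu01 y) _ _ f).
  - by rewrite esum_unit ?psum_ge0.
  - move=> x; rewrite esum_unit lee_fin ?powR_ge0//.
    by rewrite (powRr1 (bu0 y x)); have /andP[] := bu01 y x.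
  - move=> x z xz; rewrite esum_unit lee_fin ?powR_ge0//.
  rewrite powRr1//; apply: le_trans (tent_dist _ _ _ l0) _.
  rewrite ler_pdivrMr// (le_trans xz)// /l mulrDr mulr1 mulrC divfK ?gt_eqF//.
  by rewrite lerDl ltW.
exists c => //.
suff cb f : rnorm ((c - b) f) <= e * rnorm f by exact: cb.
apply: (cutoff_dense bgX r1 (ltW e0)) => {f} F g g0.
pose u y := mulx_comm (tent l y) b (mulx (delta y) g).
have gF y : y \notin F -> mulx (delta y) g = 0.
  move=> yF; apply: lp_eqP => x; rewrite (mulx_deltaE bgX) lp_zeroE.
  by rewrite (g0 y yF) if_same.
have gE : g = \sum_(y <- F) mulx (delta y) g.
  rewrite -(cutoff_sum bgX); apply: lp_eqP => x; rewrite (cutoffE bgX).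
  by case: ifPn => [//|/g0].
have tE y : mulx (tent l y) (mulx (delta y) g) = mulx (delta y) g.
  apply: lp_eqP => z; rewrite (mulxE bgX _ _ (bu1 y)) (mulx_deltaE bgX).
  by case: eqP => [->|_]; rewrite ?tentxx ?scale1r ?scaler0.
have uE y x : u y x =
    (tent l y x)%:C *: b (mulx (delta y) g) x - b (mulx (delta y) g) x.
  by rewrite /u /mulx_comm tE lp_subE (mulxE bgX _ _ (bu1 y)).
(* [c g x] is a sum over the ball at [x] and [b g x] one over the support [F];
   both extend by zeros to the union. *)
have key x : (c - b) g x = \sum_(y <- (fball x l `|` F)%fset) u y x.
  under eq_bigr do rewrite uE.
  rewrite sumrB; have -> : (c - b) g x = c g x - b g x by [].
  congr (_ - _).
    rewrite cE; apply: big_fset_incl => [|y _ yx]; first exact: fsubsetUl.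
    rewrite tent_out ?scale0r// metric_sym ltW// ltNge -(in_fball bgX).
    exact: yx.
  rewrite {1}gE linear_sum lp_sumE.
  apply: big_fset_incl => [|y _ yF]; first exact: fsubsetUr.
  by rewrite gF// linear0.
have ue : (psum 1%R ((c - b)%R g) <= \esum_(y in [set: X]) psum 1%R (u y))%E.
  apply: psum_le_esum => x; rewrite key.
  apply: le_trans (sum_fset_le_esum (fball x l `|` F)%fset _); last first.
    by move=> y; exact: powR_ge0.
  rewrite lee_fin powRr1 ?rnorm_ge0//.
  apply: le_trans (rnorm_sum _ _) _; apply: ler_sum => y _.
  by rewrite powRr1 ?rnorm_ge0.
have uy y : (psum 1%R (u y) <= e%:E * psum 1%R (mulx (delta y) g))%E.
  rewrite -[e in leRHS](powRr1 (ltW e0)); apply: (psum_op_le r1 (ltW e0)).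
  rewrite /u (mulx_comm_inv _ _ ab ba) rnormN.
  apply: le_trans (op_norm_ub _ _) _.
  apply: le_trans (ler_wpM2l (op_norm_ge0 _) (ha1 _ _)) _.
  have eK0 : 0 <= op_norm b * (e / (K + 1)) by rewrite mulr_ge0 ?op_norm_ge0 ?(ltW d0).
  rewrite mulrA; apply: le_trans (ler_wpM2l eK0 (op_norm_ub _ _)) _.
  have -> : op_norm b * (e / (K + 1)) * (op_norm b * rnorm (mulx (delta y) g)) =
      e * (K / (K + 1)) * rnorm (mulx (delta y) g) by rewrite /K; ring.
  rewrite ler_wpM2r ?rnorm_ge0//.
  by rewrite ler_piMr ?(ltW e0)// ler_pdivrMr ?ltr_wpDl// mul1r lerDl.
apply: (psum_le_rnorm r1 (ltW e0)); rewrite (powRr1 (ltW e0)).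
apply: le_trans ue _; apply: le_trans (le_esum (fun y _ => uy y)) _.
have deltaE y : psum 1%R (mulx (delta y) g) = (rnorm (mulx (delta y) g))%:E.
  by rewrite lp_psumE// powRr1 ?rnorm_ge0.
under eq_esum do rewrite deltaE -EFinM.
apply: le_trans (esumZ_le (ltW e0) _) _; first by move=> y; exact: rnorm_ge0.
rewrite lee_wpmul2l ?lee_fin ?(ltW e0)//.
under eq_esum do rewrite -deltaE.
exact: (esum_mulx_le bgX _ delta01 esum_delta).
Qed.

End l1.

Lemma band_dominated_inverse_closed (R : realType) (X : metricType R)
    (p : \bar R) (hp : lp_exponent p) (E : normedModType R[i]) :
  bounded_geometry X ->
  ((1 < p)%E -> (p < +oo)%E -> property_A X) ->
  closed_under_inverses (band_dominated hp X E).
Proof.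
move=> bgX hA; have [p0|p1] := hp.
  by subst p; exact: c0_inverse_closed.
case: p hp hA p1 => [r| |] hp hA //; last by move=> _; exact: linfty_inverse_closed.
rewrite lee_fin le_eqVlt => /predU1P[r1|r1].
  by subst r; exact: l1_inverse_closed.
by apply: lr_inverse_closed (ltW r1) _ => //; apply: hA; rewrite ?lte_fin ?ltry.
Qed.

Theorem corollary6p5 (R : realType) (X : metricType R) (p : \bar R)
    (hp : lp_exponent p) :
  bounded_geometry X ->
  ((1 < p)%E -> (p < +oo)%E -> property_A X) ->
  closed_under_inverses (uniform_roe hp X) /\
  (strongly_discrete X ->
    forall E : completeNormedModType R[i],
      closed_under_inverses (band_dominated hp X E)).
Proof.
by move=> bgX hA; split=> [|_ E]; exact: band_dominated_inverse_closed.
Qed.
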